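(* Let $X\in\mathbb{R}^{n\times d}$ be a fixed design matrix satisfying the sparse eigenvalue condition with positive constants $(\kappa_u,\kappa_\ell)$: $$\kappa_\ell\|\beta\|_2\le\frac{\|X\beta\|_2}{\sqrt n}\le\kappa_u\|\beta\|_2\quad\text{for every }(2k)\text{-sparse }\beta\in\mathbb{R}^d,$$ and assume $d>k^3$. There are universal constants $c',c''>0$ such that for any $\tau>0$ the Bayes risks under the prior $w$ (depending on $\tau$; defined in the context) satisfy $$R_{\rm Bayes}(w,L_{\rm est};\Theta)\ge c'\,T(\tau)\quad\text{and}\quad R_{\rm Bayes}(w,L_{\rm pre};\Theta)\ge c''\,\kappa_\ell^2\,T(\tau),$$ where $$T(\tau):=k\tau^2\max\left\{\frac{1}{1+\kappa_u^2\tau^2n/\sigma^2},\ \exp\left(-\frac{4\kappa_u^2n}{\sigma^2}\left[\tau^2-\frac{\sigma^2\log(d/k)}{16\kappa_u^2n}\right]_+\right)\right\}.$$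
   Context: Sparse linear regression: one observes $y=X\theta+\varepsilon$ with $\varepsilon\sim N(0,\sigma^2I_{n\times n})$, where $\theta\in\Theta:=\{\theta\in\mathbb{R}^d:\|\theta\|_0\le k\}$ is unknown. The action space is $\mathbb{R}^d$, so estimators need not be sparse. The losses are the estimation error $L_{\rm est}(\theta,\widehat\theta):=\|\widehat\theta-\theta\|_2^2$ and the prediction error $L_{\rm pre}(\theta,\widehat\theta):=\frac1n\|X\widehat\theta-X\theta\|_2^2$. The prior $w$ on $\Theta$: first draw a subset $K\subset\{1,\dots,d\}$ of $k$ indices uniformly at random; then draw $\theta_i\sim N(0,\tau^2)$ independently for $i\in K$ and set $\theta_i=0$ for $i\notin K$. The Bayes risk is $R_{\rm Bayes}(w,L;\Theta):=\inf_{\widehat\theta}\int_\Theta\mathbb{E}_\theta L(\theta,\widehat\theta(y))\,w(\mathrm{d}\theta)$, the infimum over all estimators $\widehat\theta:\mathbb{R}^n\to\mathbb{R}^d$, with $\mathbb{E}_\theta$ the expectation over $y\sim N(X\theta,\sigma^2I_{n\times n})$. A vector is $s$-sparse if it has at most $s$ nonzero entries. $[x]_+:=\max\{x,0\}$. *)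

(* Defs.v *)
From HB Require Import structures.
From mathcomp Require Import all_boot all_order all_algebra.
From mathcomp Require Import all_classical all_reals all_analysis.

Set Implicit Arguments.
Unset Strict Implicit.
Unset Printing Implicit Defensive.

Import Order.TTheory GRing.Theory Num.Theory.
Import numFieldNormedType.Exports.

Local Open Scope classical_set_scope.
Local Open Scope ring_scope.

Section product_law.
Context d (T : measurableType d) (R : realType).

Definition tcons n (x : T * n.-tuple T) : n.+1.-tuple T := [tuple of x.1 :: x.2].

Let measurable_tcons n : measurable_fun [set: T * n.-tuple T] (@tcons n).
Proof. exact: measurable_cons. Qed.

HB.instance Definition _ n :=
  isMeasurableFun.Build _ _ _ _ (@tcons n) (@measurable_tcons n).

(* The law of a vector whose coordinates are independent, the i-th one with
   law P i; product_lawE below characterizes it on boxes. *)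
Fixpoint product_law n : ('I_n -> probability T R) -> probability (n.-tuple T) R :=
  match n with
  | 0 => fun=> dirac [tuple]
  | n'.+1 => fun P => distribution
      (P ord0 \x product_law (fun i => P (lift ord0 i)))%E (@tcons n')
  end.

Lemma product_lawE n (P : 'I_n -> probability T R) (A : 'I_n -> set T) :
  (forall i, measurable (A i)) ->
  product_law P [set t | forall i, A i (tnth t i)] = (\prod_i P i (A i))%E.
Proof.
elim: n P A => [|n IHn] P A mA.
  rewrite big_ord0 /= diracE mem_set//; by case.
rewrite big_ord_recl -IHn//= /distribution /pushforward.
rewrite -product_measure1E//; last first.
  rewrite (_ : [set _ | _] =
      \big[setI/setT]_(i < n) ((@tnth n T)^~ i @^-1` A (lift ord0 i))).
    apply: bigsetI_measurable => i _; rewrite -[X in measurable X]setTI.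
    exact: measurable_tnth.
  rewrite -bigcap_seq; apply/seteqP; split => t /= H i; first by move=> _; exact: H.
  by apply: (H i); rewrite /= mem_index_enum.
congr (_ _); apply/seteqP; split => -[x t] /=.
  move=> H; split => [|i]; first by have := H ord0.
  by have := H (lift ord0 i); rewrite tnthS.
move=> [H0 H] i; case: (unliftP ord0 i) => [j ->|->]; first by rewrite tnthS.
exact: H0.
Qed.

End product_law.

Section sparse_regression.
Context (R : realType).

(* Vectors carry their product sigma-algebra as tuples; linear algebra is done
   on the corresponding column. *)
Definition vec n (t : n.-tuple R) : 'cV[R]_n := \col_i tnth t i.

(* Not `|v|, which is the sup norm on matrices. *)
Definition norm2 n (v : 'cV[R]_n) : R := Num.sqrt (\sum_i v i 0 ^+ 2).

Definition norm0 n (v : 'cV[R]_n) : nat := #|[pred i | v i 0 != 0]|.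

Definition sparse_vectors d k : set (d.-tuple R) :=
  [set theta | (norm0 (vec theta) <= k)%N].

Definition sparse_eigenvalue_condition n d (X : 'M[R]_(n, d)) (s : nat)
    (kappa_u kappa_l : R) : Prop :=
  forall beta : 'cV[R]_d, (norm0 beta <= s)%N ->
    kappa_l * norm2 beta <= norm2 (X *m beta) / Num.sqrt n%:R
                         <= kappa_u * norm2 beta.

Definition loss_est d (theta theta' : 'cV[R]_d) : R :=
  norm2 (theta' - theta) ^+ 2.

Definition loss_pre n d (X : 'M[R]_(n, d)) (theta theta' : 'cV[R]_d) : R :=
  n%:R^-1 * norm2 (X *m theta' - X *m theta) ^+ 2.

(* normal_prob is a measure on measurableTypeR R, whose measurable sets are those
   of R but whose display differs; normal_law is its transport to R. Its second
   parameter is the standard deviation. *)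
Definition idTR : measurableTypeR R -> R := idfun.

HB.instance Definition _ :=
  @isMeasurableFun.Build _ _ _ _ idTR (@measurable_id _ _ setT).

Definition normal_law (m s : R) : probability R R :=
  distribution (normal_prob m s) idTR.

Lemma normal_lawE (m s : R) (A : set R) : normal_law m s A = normal_prob m s A.
Proof. by []. Qed.

(* N(mu, sigma^2 I). *)
Definition gaussian n (mu : 'cV[R]_n) (sigma : R) : probability (n.-tuple R) R :=
  product_law (fun i => normal_law (mu i 0) sigma).

Section prior.
Local Open Scope ereal_scope.
Variables (d k : nat) (tau : R).

Definition prior_coord (K : {set 'I_d}) (i : 'I_d) : probability R R :=
  if i \in K then normal_law 0%R tau else dirac (0%R : R).

(* Uniform mixture over the 'C(d, k) supports of cardinality k. *)
Definition prior (A : set (d.-tuple R)) : \bar R :=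
  ('C(d, k)%:R^-1)%:E *
    \sum_(K : {set 'I_d} | #|K| == k) product_law (prior_coord K) A.

Let prior0 : prior set0 = 0.
Proof. by rewrite /prior big1 ?mule0// => K _; rewrite measure0. Qed.

Let prior_ge0 A : 0 <= prior A.
Proof.
by rewrite /prior mule_ge0 ?lee_fin ?invr_ge0// sume_ge0.
Qed.

Let prior_sigma_additive : semi_sigma_additive prior.
Proof.
move=> F mF tF mUF; rewrite [X in _ --> X](_ : _ =
    lim ((fun n => \sum_(0 <= i < n) prior (F i)) @ \oo)).
  by apply: is_cvg_ereal_nneg_natsum => i _; exact: prior_ge0.
rewrite /prior nneseriesZl//; last by move=> i _; exact: sume_ge0.
rewrite nneseries_sum//; congr (_ * _); apply: eq_bigr => K _.
exact: measure_semi_bigcup.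
Qed.

HB.instance Definition _ := isMeasure.Build _ _ _ prior
  prior0 prior_ge0 prior_sigma_additive.

Lemma prior_setT : (k <= d)%N -> prior [set: d.-tuple R] = 1.
Proof.
move=> kd; rewrite /prior (eq_bigr (fun=> 1%:E)); last first.
  by move=> K _; rewrite probability_setT.
rewrite sumEFin sumr_const -EFinM (_ : #|_| = 'C(d, k)).
  by rewrite mulVf// pnatr_eq0 -lt0n bin_gt0.
by rewrite -[d in RHS]card_ord -(card_draws 'I_d k) cardsE.
Qed.

End prior.

(* Estimators are the Borel functions from R^n to R^d; the risks of an
   estimator are extended real numbers, possibly +oo. *)
Definition bayes_risk n d (X : 'M[R]_(n, d)) (sigma : R)
    (w : {measure set (d.-tuple R) -> \bar R})
    (L : 'cV[R]_d -> 'cV[R]_d -> R) (Theta : set (d.-tuple R)) : \bar R :=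
  ereal_inf (range (fun est : {mfun n.-tuple R >-> d.-tuple R} =>
    \int[w]_(theta in Theta)
      \int[gaussian (X *m vec theta) sigma]_y
        (L (vec theta) (vec (est y)))%:E)%E).

Definition T_rate (n d k : nat) (kappa_u sigma tau : R) : R :=
  k%:R * tau ^+ 2 *
  Num.max
    (1 / (1 + kappa_u ^+ 2 * tau ^+ 2 * n%:R / sigma ^+ 2))
    (expR (- (4 * kappa_u ^+ 2 * n%:R / sigma ^+ 2 *
      Num.max (tau ^+ 2 - sigma ^+ 2 * ln (d%:R / k%:R)
                          / (16 * kappa_u ^+ 2 * n%:R)) 0))).

End sparse_regression.

Arguments prior {R} d k tau A.
Arguments sparse_vectors {R} d k theta.
Arguments loss_est {R d} theta theta'.

(* Main.v *)
Require Import Defs.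
From HB Require Import structures.
From mathcomp Require Import all_boot all_order all_algebra.
From mathcomp Require Import all_classical all_reals all_analysis measurable_realfun.
From mathcomp Require Import ring lra.

Set Implicit Arguments.
Unset Strict Implicit.
Unset Printing Implicit Defensive.

Import Order.TTheory GRing.Theory Num.Theory.
Import numFieldNormedType.Exports.

Local Open Scope classical_set_scope.
Local Open Scope ring_scope.

(** The risk of an estimator splits over the coordinates j, and for each of them
    over the supports K of the prior.  Two lower bounds are proved for the
    contribution of j; s stands for the signal-to-noise ratio
    kappa_u^2 tau^2 n / sigma^2, which bounds tau^2 |X_i|^2 / sigma^2 for every
    column X_i of X.

    If j belongs to K and everything except theta_j is revealed, y is a noisy
    observation of theta_j X_j and the posterior of theta_j is normal with
    variance at least tau^2 / (1 + s), whatever y is.  This gives a risk of order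
    k tau^2 / (1 + s) (bayes_risk_est_oracle).

    If s is at most ln (d / k) / 12, not knowing the support already costs order
    k tau^2 (bayes_risk_est_sparse).  Reveal K \ j and the values there.  The spike
    sits at j, with an amplitude t of order tau, or at one of the d - k positions
    outside K; in the latter case the j-th coordinate of the estimator should be
    0.  Averaging over the amplitude, the density of y under a spike at i is at
    least (1 + s)^(-1/2) times its density without a spike
    (normal_mixture_ge), uniformly in i, so the alternatives together weigh at
    least W = (d - k) / k * (1 + s)^(-1/2) against the spike at j.  The factor 1 / k
    is there because a support that misses j can be reached by moving the spike j
    of k different supports (sum_exchange_support, sum_support_ge).  Now W exceeds
    the second moment exp (t^2 |X_j|^2 / sigma^2) of the likelihood ratio between
    spike and no spike, so the estimator cannot be accurate in both cases
    (gaussian_two_point).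

    For s > ln (d / k) / 12 the exponential in the rate is at most exp (- s), hence
    at most 1 / (1 + s), and the first bound suffices (T_rate_le).

    For the prediction loss, any estimator can be replaced by the k-sparse vector
    whose prediction is closest to its own.  This at most doubles the distance
    between the predictions, and the difference with theta is then 2k-sparse, so
    the lower eigenvalue condition turns the prediction error into an estimation
    error (bayes_risk_pre_ge). *)

(** * Normal laws on the line *)

Section normal.
Local Open Scope ereal_scope.

(** A density is only determined almost everywhere: it agrees with the
    Radon-Nikodym derivative off a null set, which no integral sees. *)
Lemma ge0_integral_density d (T : measurableType d) (R : realType)
    (nu : {finite_measure set T -> \bar R})
    (mu : {sigma_finite_measure set T -> \bar R}) (g : T -> R) (f : T -> \bar R) :
  (forall A, measurable A -> nu A = \int[mu]_(x in A) (g x)%:E) ->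
  nu `<< mu -> mu.-integrable setT (EFin \o g) ->
  measurable_fun setT f -> (forall x, 0 <= f x) ->
  \int[nu]_x f x = \int[mu]_x (f x * (g x)%:E).
Proof.
move=> nuE numu ig mf f0.
have mg := measurable_int mu ig.
rewrite -(Radon_Nikodym_SigmaFinite.change_of_variables numu)//.
have id := Radon_Nikodym_SigmaFinite.f_integrable numu.
have md := measurable_int mu id.
apply: ae_eq_integral => //; [exact: emeasurable_funM|exact: emeasurable_funM|].
apply: ae_eqe_mul2l; apply: integral_ae_eq => //.
by move=> A _ mA; rewrite -(Radon_Nikodym_SigmaFinite.f_integral numu)// -nuE.
Qed.

Lemma integral_probability_cst d (T : measurableType d) (R : realType)
    (P : probability T R) (c : \bar R) : \int[P]_x c = c.
Proof.
rewrite integral_cst// -[RHS]mule1; congr (_ * _)%E; exact: probability_setT.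
Qed.

Lemma ge0_integral_normal_law (R : realType) (m s : R) (f : R -> \bar R) :
  measurable_fun setT f -> (forall x, 0 <= f x) ->
  \int[normal_law m s]_x f x =
  \int[lebesgue_measure]_x (f x * (normal_pdf m s x)%:E).
Proof.
move=> mf f0; rewrite /normal_law.
rewrite ge0_integral_distribution//.
apply: ge0_integral_density => //.
- exact: normal_prob_dominates.
- exact: integrable_normal_pdf.
Qed.

(** All changes of normal law below are done at the level of densities, so each
    of them rests on a pointwise identity between two normal densities. *)
Lemma integral_normal_law_reweight (R : realType) (m s m' s' : R) (h : R -> R)
    (f : R -> \bar R) :
  measurable_fun setT h -> (forall x, 0 <= h x)%R ->
  (forall x, normal_pdf m s x = normal_pdf m' s' x * h x)%R ->
  measurable_fun setT f -> (forall x, 0 <= f x) ->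
  \int[normal_law m s]_x f x = \int[normal_law m' s']_x ((h x)%:E * f x).
Proof.
move=> mh h0 hE mf f0; rewrite !ge0_integral_normal_law//.
- by apply: eq_integral => x _; rewrite hE EFinM muleCA [RHS]muleC (muleC (f x)).
- by apply: emeasurable_funM => //; exact/measurable_EFinP.
- by move=> x; rewrite mule_ge0// lee_fin.
Qed.

Lemma normal_peakE (R : realType) (s : R) : (0 < s)%R ->
  normal_peak s = (s * Num.sqrt (pi *+ 2))^-1%R.
Proof.
by move=> s0; rewrite /normal_peak -mulrnAr sqrtrM ?sqr_ge0// sqrtr_sqr gtr0_norm.
Qed.

Lemma normal_pdf_shift (R : realType) (m h s x : R) : (0 < s)%R ->
  (normal_pdf (m + h) s x =
   normal_pdf m s x * expR ((x - m) * h / s ^+ 2 - h ^+ 2 / s ^+ 2 / 2))%R.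
Proof.
move=> s0; rewrite !normal_pdfE ?gt_eqF//= -[RHS]mulrA; congr *%R.
rewrite /normal_fun -expRD; congr expR; rewrite !mulr2n; field.
by rewrite -mulr2n mulrn_eq0 sqrf_eq0 (gt_eqF s0).
Qed.

(** Completing the square: a centred normal prior of standard deviation s times
    a likelihood that is log-quadratic in x is an unnormalized normal posterior,
    of precision 1 / r ^+ 2 = 1 / s ^+ 2 + v. *)
Lemma normal_pdf_tilt (R : realType) (s u v x : R) : (0 < s)%R -> (0 <= v)%R ->
  let r := (s / Num.sqrt (1 + s ^+ 2 * v))%R in
  (normal_pdf 0 s x * expR (x * u - x ^+ 2 * v / 2) =
   r / s * expR (u ^+ 2 * r ^+ 2 / 2) * normal_pdf (u * r ^+ 2) r x)%R.
Proof.
move=> s0 v0 r.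
have q0 : (0 < 1 + s ^+ 2 * v)%R by rewrite ltr_pwDl// mulr_ge0// sqr_ge0.
have r0 : (0 < r)%R by rewrite divr_gt0// sqrtr_gt0.
have r2 : (r ^+ 2 = s ^+ 2 / (1 + s ^+ 2 * v))%R by rewrite expr_div_n sqr_sqrtr// ltW.
have sn : (s != 0)%R by rewrite gt_eqF.
have rn : (r != 0)%R by rewrite gt_eqF.
clearbody r.
have pk : (normal_peak s = r / s * normal_peak r)%R.
  rewrite !normal_peakE//; set q := Num.sqrt _.
  have qn : (q != 0)%R by rewrite gt_eqF// sqrtr_gt0 pmulrn_lgt0// pi_gt0.
  by field; rewrite rn sn qn.
rewrite !normal_pdfE//= pk -[LHS]mulrA [RHS]mulrACA; congr *%R.
rewrite /normal_fun -!expRD; congr expR; rewrite r2 !mulr2n; field.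
by rewrite (gt_eqF q0) -mulr2n mulrn_eq0 sqrf_eq0 (negbTE sn).
Qed.

Lemma integral_normal_law_shift (R : realType) (m h s : R) (f : R -> \bar R) :
  (0 < s)%R -> measurable_fun setT f -> (forall x, 0 <= f x) ->
  \int[normal_law (m + h) s]_x f x = \int[normal_law m s]_x
    ((expR ((x - m) * h / s ^+ 2 - h ^+ 2 / s ^+ 2 / 2))%:E * f x).
Proof.
move=> s0 mf f0; apply: integral_normal_law_reweight => //.
- apply: measurableT_comp => //; apply: measurable_funB => //.
  by do 2 apply: measurable_funM => //; exact: measurable_funB.
- by move=> x; exact: normal_pdf_shift.
Qed.

Lemma integral_normal_law_tilt (R : realType) (s u v : R) (f : R -> \bar R) :
  (0 < s)%R -> (0 <= v)%R -> measurable_fun setT f -> (forall x, 0 <= f x) ->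
  let r := (s / Num.sqrt (1 + s ^+ 2 * v))%R in
  \int[normal_law 0 s]_x ((expR (x * u - x ^+ 2 * v / 2))%:E * f x) =
  (r / s * expR (u ^+ 2 * r ^+ 2 / 2))%:E *
    \int[normal_law (u * r ^+ 2) r]_x f x.
Proof.
move=> s0 v0 mf f0 r.
have mh : measurable_fun setT (fun x : R => expR (x * u - x ^+ 2 * v / 2)).
  apply: measurableT_comp => //; apply: measurable_funB => //.
    exact: measurable_funM.
  by do 2 apply: measurable_funM => //; exact: measurable_funX.
have c0 : (0 <= r / s * expR (u ^+ 2 * r ^+ 2 / 2))%R.
  by rewrite mulr_ge0 ?expR_ge0// !divr_ge0 ?sqrtr_ge0 ?ltW.
rewrite !ge0_integral_normal_law//; first last.
- by move=> x; rewrite mule_ge0// lee_fin expR_ge0.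
- by apply: emeasurable_funM => //; exact/measurable_EFinP.
rewrite -ge0_integralZl//; first last.
- by move=> x _; rewrite mule_ge0// lee_fin normal_pdf_ge0.
- apply: emeasurable_funM => //; apply/measurable_EFinP.
  exact: measurable_normal_pdf.
apply: eq_integral => x _.
rewrite muleAC -EFinM mulrC normal_pdf_tilt// EFinM -/r.
by rewrite -muleA (muleC _ (f x)).
Qed.

(** Within two standard deviations of the mean the normal density is at least
    e^(-2) / (s sqrt (2 pi)); times the length s of an interval, this no longer
    depends on s. *)
Definition normal_itv_mass (R : realType) : R := (expR (- 2) / Num.sqrt (pi *+ 2))%R.

Lemma normal_itv_mass_gt0 (R : realType) : (0 < normal_itv_mass R)%R.
Proof. by rewrite divr_gt0 ?expR_gt0// sqrtr_gt0 pmulrn_lgt0// pi_gt0. Qed.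

Lemma normal_law_itv_ge (R : realType) (m s c : R) : (0 < s)%R ->
  (m - 2 * s <= c)%R -> (c <= m + s)%R ->
  (normal_itv_mass R)%:E <= normal_law m s (`[c, (c + s)%R]%classic).
Proof.
move=> s0 mc cm; rewrite normal_lawE /normal_prob.
have ss : (c < c + s)%R by lra.
apply: (@le_trans _ _ (\int[lebesgue_measure]_(x in `[c, (c + s)%R])
    (normal_peak s * expR (- 2))%:E)).
  rewrite integral_cst//= lebesgue_measure_itv/= lte_fin ss -EFinD -EFinM lee_fin.
  rewrite normal_peakE// /normal_itv_mass; set q := Num.sqrt _.
  rewrite le_eqVlt; apply/orP; left; apply/eqP.
  have qn : (q != 0)%R by rewrite gt_eqF// sqrtr_gt0 pmulrn_lgt0// pi_gt0.
  by field; rewrite qn gt_eqF.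
apply: ge0_le_integral => //.
- by move=> x _; rewrite lee_fin mulr_ge0 ?expR_ge0 ?normal_peak_ge0.
- apply/measurable_funTS/measurable_EFinP; exact: measurable_normal_pdf.
- move=> x /=; rewrite in_itv/= => /andP[sx xs].
  rewrite lee_fin normal_pdfE ?gt_eqF//= ler_wpM2l ?normal_peak_ge0//.
  rewrite /normal_fun ler_expR mulNr lerN2 ler_pdivrMr; last first.
    by rewrite pmulrn_lgt0// exprn_gt0.
  rewrite mulr2n; nra.
Qed.

(** A guess a lies on one side of the mean, hence at distance at least s from
    an interval of length s on the other side, whose mass is bounded below. *)
Lemma normal_law_mse_ge (R : realType) (m s a : R) : (0 < s)%R ->
  (normal_itv_mass R * s ^+ 2)%:E <= \int[normal_law m s]_x ((a - x) ^+ 2)%:E.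
Proof.
move=> s0.
have key c : (m - 2 * s <= c)%R -> (c <= m + s)%R ->
    (forall x, x \in `[c, (c + s)%R] -> s ^+ 2 <= (a - x) ^+ 2)%R ->
    (normal_itv_mass R * s ^+ 2)%:E <= \int[normal_law m s]_x ((a - x) ^+ 2)%:E.
  move=> mc cm H; have mI : measurable `[c, (c + s)%R]%classic by exact: measurable_itv.
  have mf : measurable_fun setT (fun x : R => ((a - x) ^+ 2)%:E).
    by apply/measurable_EFinP; apply: measurable_funX; exact: measurable_funB.
  apply: (@le_trans _ _ (\int[normal_law m s]_(x in `[c, (c + s)%R]) (s ^+ 2)%:E)).
    rewrite integral_cst//= EFinM muleC lee_pmul2l//; last by rewrite lte_fin exprn_gt0.
    exact: normal_law_itv_ge.
  apply: (@le_trans _ _ (\int[normal_law m s]_(x in `[c, (c + s)%R]) ((a - x) ^+ 2)%:E)).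
    apply: ge0_le_integral => //.
    - by move=> x _; rewrite lee_fin sqr_ge0.
    - exact: measurable_funTS.
  by apply: (ge0_subset_integral _ mI measurableT mf) => // x _; rewrite lee_fin sqr_ge0.
(* The interval starts at m + s or ends at m - s. *)
have [am|ma] := leP a m.
- apply: (key (m + s)%R); [lra|lra|move=> x]; rewrite in_itv/= => /andP[h1 h2]; nra.
- apply: (key (m - 2 * s)%R); [lra|lra|move=> x]; rewrite in_itv/= => /andP[h1 h2]; nra.
Qed.
End normal.

(** * Product laws *)

Section product_law.
Local Open Scope ereal_scope.
Context d (T : measurableType d) (R : realType).

Lemma measurable_tcons n :
  measurable_fun [set: T * n.-tuple T] (fun z => [tuple of z.1 :: z.2]).
Proof. exact: measurable_cons. Qed.

Lemma integral_product_law0 (P : 'I_0 -> probability T R) (f : 0.-tuple T -> \bar R) :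
  measurable_fun setT f -> \int[product_law P]_t f t = f [tuple].
Proof.
move=> mf; rewrite /= integral_dirac//.
by rewrite diracE mem_set// mul1e.
Qed.

Lemma integral_product_lawS n (P : 'I_n.+1 -> probability T R)
    (f : n.+1.-tuple T -> \bar R) :
  measurable_fun setT f -> (forall x, 0 <= f x) ->
  \int[product_law P]_t f t =
  \int[P ord0]_x \int[product_law (fun i => P (lift ord0 i))]_t
    f [tuple of x :: t].
Proof.
move=> mf f0; rewrite [product_law P]/=.
rewrite ge0_integral_distribution// fubini_tonelli1//.
  exact: measurableT_comp.
by move=> z; exact: f0.
Qed.

Lemma measurable_integral_product_law n (P : 'I_n -> probability T R)
    d' (T' : measurableType d') (f : T' * n.-tuple T -> \bar R) :
  measurable_fun setT f -> (forall x, 0 <= f x) ->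
  measurable_fun setT (fun x => \int[product_law P]_t f (x, t)).
Proof. by move=> mf f0; exact: measurable_fun_fubini_tonelli_F. Qed.

Lemma measurable_prod_tnth n (w : 'I_n -> T -> R) :
  (forall i, measurable_fun setT (w i)) ->
  measurable_fun setT (fun t : n.-tuple T => \prod_i w i (tnth t i))%R.
Proof.
move=> mw; apply: measurable_prod => i _.
by apply: measurableT_comp => //; exact: measurable_tnth.
Qed.

(** Densities of independent coordinates multiply: Fubini peels off the first
    coordinate, and induction handles the others. *)
Lemma integral_product_law_reweight n (P Q : 'I_n -> probability T R)
    (w : 'I_n -> T -> R) :
  (forall i, measurable_fun setT (w i)) -> (forall i x, 0 <= w i x)%R ->
  (forall i f, measurable_fun setT f -> (forall x, 0 <= f x) ->
    \int[P i]_x f x = \int[Q i]_x ((w i x)%:E * f x)) ->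
  forall f, measurable_fun setT f -> (forall x, 0 <= f x) ->
  \int[product_law P]_t f t =
  \int[product_law Q]_t ((\prod_i w i (tnth t i))%:E * f t).
Proof.
elim: n P Q w => [|n IHn] P Q w mw w0 PQ f mf f0.
  rewrite !integral_product_law0//; last by under eq_fun do rewrite big_ord0 mul1e.
  by rewrite big_ord0 mul1e.
have mwf : measurable_fun setT
    (fun t : n.+1.-tuple T => (\prod_i w i (tnth t i))%:E * f t).
  apply: emeasurable_funM => //; apply/measurable_EFinP.
  exact: measurable_prod_tnth.
have mfc : measurable_fun setT
    (fun z : T * n.-tuple T => f [tuple of z.1 :: z.2]).
  by apply: measurableT_comp => //; exact: measurable_tcons.
rewrite !integral_product_lawS//; last first.
  by move=> t; rewrite mule_ge0// lee_fin prodr_ge0.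
rewrite PQ//; first last.
- by move=> x; exact: integral_ge0.
- exact: (@measurable_integral_product_law _ (fun i => P (lift ord0 i)) _ _
    (fun z : T * n.-tuple T => f [tuple of z.1 :: z.2])).
apply: eq_integral => x _.
have mfx : measurable_fun setT (fun t : n.-tuple T => f [tuple of x :: t]).
  exact: (measurableT_comp mfc (pair1_measurable x)).
rewrite (IHn _ (fun i => Q (lift ord0 i)) (fun i => w (lift ord0 i)))//; last first.
  by move=> i g mg g0; exact: PQ.
rewrite -ge0_integralZl//; first last.
- by rewrite lee_fin.
- by move=> t _; rewrite mule_ge0// lee_fin prodr_ge0.
- apply: emeasurable_funM => //; apply/measurable_EFinP.
  exact: (@measurable_prod_tnth _ (fun i => w (lift ord0 i))).
apply: eq_integral => t _; rewrite muleA -EFinM big_ord_recl.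
congr ((_ * _)%:E * _)%E.
by apply: eq_bigr => i _; rewrite tnthS.
Qed.

End product_law.

(** * Adding a random spike to a product law *)

Section insertion.
Local Open Scope ereal_scope.
Context (R : realType).

Definition add_coord n (j : 'I_n) (theta : n.-tuple R) (t : R) : n.-tuple R :=
  [tuple (tnth theta i + (if i == j then t else 0))%R | i < n].

Lemma add_coord_head n (theta : n.-tuple R) (x t : R) :
  add_coord ord0 [tuple of x :: theta] t = [tuple of (x + t)%R :: theta].
Proof.
apply: eq_from_tnth => i; rewrite tnth_mktuple.
by case: (unliftP ord0 i) => [j ->|->]; rewrite ?tnthS ?addr0.
Qed.

Lemma add_coord_lift n (j : 'I_n) (theta : n.-tuple R) (x t : R) :
  add_coord (lift ord0 j) [tuple of x :: theta] t =
  [tuple of x :: add_coord j theta t].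
Proof.
apply: eq_from_tnth => i; rewrite tnth_mktuple.
case: (unliftP ord0 i) => [l ->|->]; last by rewrite addr0.
by rewrite !tnthS tnth_mktuple (inj_eq lift_inj).
Qed.

Lemma measurable_add_coord n (j : 'I_n) :
  measurable_fun setT (fun z : n.-tuple R * R => add_coord j z.1 z.2).
Proof.
apply/measurable_fun_tnthP => i /=.
rewrite [X in measurable_fun _ X](_ : _ = (fun z : n.-tuple R * R =>
    tnth z.1 i + (if i == j then z.2 else 0))%R); last first.
  by apply/funext => z; rewrite /= tnth_mktuple.
apply: measurable_funD; first exact: (measurableT_comp (measurable_tnth i) measurable_fst).
by case: (i == j); [exact: measurable_snd|exact: measurable_cst].
Qed.

(** A coordinate frozen at 0 can be made random after all the others have been
    drawn.  Applied to the prior, it presents a draw with support i |: K as a draw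
    with support K to which one spike is added. *)
Lemma integral_product_law_insert n (j : 'I_n) (N : probability R R)
    (P P' : 'I_n -> probability R R) (f : n.-tuple R -> \bar R) :
  P j = dirac (0%R : R) -> P' j = N -> (forall i, i != j -> P' i = P i) ->
  measurable_fun setT f -> (forall x, 0 <= f x) ->
  \int[product_law P']_theta f theta =
  \int[product_law P]_theta \int[N]_t f (add_coord j theta t).
Proof.
elim: n j P P' f => [|n IHn] j P P' f Pj P'j PP' mf f0; first by case: j Pj P'j PP'.
have mfj : measurable_fun setT (fun z : n.+1.-tuple R * R => f (add_coord j z.1 z.2)).
  by apply: measurableT_comp => //; exact: measurable_add_coord.
have mfc : measurable_fun setT (fun z : R * n.-tuple R => f [tuple of z.1 :: z.2]).
  by apply: measurableT_comp => //; exact: measurable_tcons.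
rewrite !integral_product_lawS//; first last.
- by move=> x; exact: integral_ge0.
- exact: (measurable_fun_fubini_tonelli_F
    (fun z : n.+1.-tuple R * R => f (add_coord j z.1 z.2))).
have mM : measurable_fun setT
    (fun z : R * n.-tuple R => \int[N]_u f (add_coord j [tuple of z.1 :: z.2] u)).
  apply: (@measurableT_comp _ _ _ _ _ _ (fun t => \int[N]_u f (add_coord j t u))).
    exact: (measurable_fun_fubini_tonelli_F
      (fun z : n.+1.-tuple R * R => f (add_coord j z.1 z.2))).
  exact: measurable_tcons.
case: (unliftP ord0 j) => [l jl|j0].
- rewrite (PP' ord0) ?jl ?neq_lift//; apply: eq_integral => x _.
  rewrite (IHn l (fun i => P (lift ord0 i))) -?jl//.
  + by apply: eq_integral => t _; apply: eq_integral => u _; rewrite jl add_coord_lift.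
  + by move=> i il; rewrite PP'// jl (inj_eq lift_inj).
  + exact: (measurableT_comp mfc (pair1_measurable x)).
- rewrite j0 in Pj P'j PP' mM *; rewrite Pj P'j integral_dirac//; last first.
    apply: (@measurable_integral_product_law _ _ _ _ _ _ _ (fun z : R * n.-tuple R =>
      \int[N]_u f (add_coord ord0 [tuple of z.1 :: z.2] u))) => // z.
    exact: integral_ge0.
  rewrite diracE mem_set// mul1e.
  rewrite (_ : (fun i => P' (lift ord0 i)) = (fun i => P (lift ord0 i))); last first.
    by apply/funext => i; rewrite PP'// eq_sym neq_lift.
  rewrite (fubini_tonelli (fun z : R * n.-tuple R => f [tuple of z.1 :: z.2]))//.
  apply: eq_integral => t _; apply: eq_integral => u _.
  by rewrite add_coord_head add0r.
Qed.
End insertion.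

(** * Gaussian shifts and likelihood ratios *)

Section gaussian.
Local Open Scope ereal_scope.
Context (R : realType).

(** Logarithm of the density of N(mu + h, sigma^2 I) with respect to
    N(mu, sigma^2 I). *)
Definition log_ratio n (mu h : 'cV[R]_n) (sigma : R) (y : n.-tuple R) : R :=
  (\sum_i ((tnth y i - mu i 0) * h i 0 / sigma ^+ 2 - h i 0 ^+ 2 / sigma ^+ 2 / 2))%R.

Lemma measurable_log_ratio n (mu h : 'cV[R]_n) (sigma : R) :
  measurable_fun setT (log_ratio mu h sigma).
Proof.
apply: measurable_sum => i.
apply: measurable_funB => //; do 2 apply: measurable_funM => //.
by apply: measurable_funB => //; exact: measurable_tnth.
Qed.

Lemma measurable_expR_log_ratio n (mu h : 'cV[R]_n) (sigma : R) :
  measurable_fun setT (fun y => (expR (log_ratio mu h sigma y))%:E).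
Proof.
by apply/measurable_EFinP; apply: measurableT_comp => //; exact: measurable_log_ratio.
Qed.

Lemma norm2_sq n (h : 'cV[R]_n) : (norm2 h ^+ 2 = \sum_i h i 0 ^+ 2)%R.
Proof. by rewrite /norm2 sqr_sqrtr// sumr_ge0// => i _; exact: sqr_ge0. Qed.

(** For an amplitude t times a fixed direction the log-ratio is quadratic in t,
    which is the shape of likelihood that normal_pdf_tilt takes. *)
Lemma log_ratioZ n (mu h : 'cV[R]_n) (sigma t : R) (y : n.-tuple R) :
  log_ratio mu (t *: h) sigma y =
  (t * (\sum_i (tnth y i - mu i 0) * h i 0 / sigma ^+ 2) -
   t ^+ 2 * (norm2 h ^+ 2 / sigma ^+ 2) / 2)%R.
Proof.
rewrite norm2_sq /log_ratio big_split/= sumrN; congr (_ - _)%R.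
  by rewrite mulr_sumr; apply: eq_bigr => i _; rewrite mxE; ring.
by rewrite !mulr_suml !mulr_sumr mulr_suml; apply: eq_bigr => i _; rewrite mxE; ring.
Qed.

Lemma integral_gaussian_shift n (mu h : 'cV[R]_n) (sigma : R)
    (f : n.-tuple R -> \bar R) :
  (0 < sigma)%R -> measurable_fun setT f -> (forall x, 0 <= f x) ->
  \int[gaussian (mu + h)%R sigma]_y f y =
  \int[gaussian mu sigma]_y ((expR (log_ratio mu h sigma y))%:E * f y).
Proof.
move=> s0 mf f0; rewrite /gaussian.
pose w i x := (expR ((x - mu i 0) * h i 0 / sigma ^+ 2 - h i 0 ^+ 2 / sigma ^+ 2 / 2))%R.
have mw i : measurable_fun setT (w i).
  apply: measurableT_comp => //; apply: measurable_funB => //.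
  by do 2 apply: measurable_funM => //; exact: measurable_funB.
have w0 i x : (0 <= w i x)%R by exact: expR_ge0.
have Pw i g : measurable_fun setT g -> (forall x, 0 <= g x) ->
    \int[normal_law ((mu + h)%R i 0%R) sigma]_x g x =
    \int[normal_law (mu i 0%R) sigma]_x ((w i x)%:E * g x).
  by move=> mg g0; rewrite mxE integral_normal_law_shift.
rewrite (integral_product_law_reweight mw w0 Pw mf f0).
by apply: eq_integral => y _; rewrite /log_ratio expR_sum.
Qed.

Lemma integral_gaussian_ratio n (mu h : 'cV[R]_n) (sigma : R) : (0 < sigma)%R ->
  \int[gaussian mu sigma]_y (expR (log_ratio mu h sigma y))%:E = 1.
Proof.
move=> s0.
rewrite -[RHS](integral_probability_cst (gaussian (mu + h)%R sigma)).
rewrite integral_gaussian_shift//.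
by apply: eq_integral => y _; rewrite mule1.
Qed.

(** The square of the ratio for h is a constant times the ratio for 2 h, which
    integrates to 1. *)
Lemma integral_gaussian_ratio_sq n (mu h : 'cV[R]_n) (sigma : R) : (0 < sigma)%R ->
  \int[gaussian mu sigma]_y (expR (log_ratio mu h sigma y) ^+ 2)%:E =
  (expR (norm2 h ^+ 2 / sigma ^+ 2))%:E.
Proof.
move=> s0.
under eq_integral => y _.
  rewrite (_ : _ ^+ 2 = expR (norm2 h ^+ 2 / sigma ^+ 2) *
      expR (log_ratio mu (2 *: h) sigma y))%R; last first.
    rewrite -[h in LHS]scale1r !log_ratioZ expr2 -!expRD; congr expR; field.
    by rewrite gt_eqF.
  rewrite EFinM; over.
rewrite ge0_integralZl//; first last.
- exact: measurable_expR_log_ratio.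
by rewrite integral_gaussian_ratio// mule1.
Qed.

(** The minimum over a of the first two terms on the right is
    r W / (r + W) * t ^+ 2.  The bound is weaker, but quadratic in r, so that it
    integrates exactly when r is a Gaussian likelihood ratio. *)
Lemma two_point_ineq (r W a t : R) : (0 < r)%R -> (0 < W)%R ->
  (t ^+ 2 / 2 * r <= r * (a - t) ^+ 2 + W * a ^+ 2 + t ^+ 2 / (8 * W) * r ^+ 2)%R.
Proof.
move=> r0 W0; rewrite -subr_ge0.
have rW : (0 < r + W)%R by exact: addr_gt0.
rewrite [leRHS](_ : _ = (8 * W * (r * a + W * a - r * t) ^+ 2 +
   t ^+ 2 * r * ((2 * W - r) ^+ 2 + r * W)) / (8 * W * (r + W)))%R; last first.
  by field; rewrite !gt_eqF.
apply: divr_ge0; last by rewrite ltW// !mulr_gt0.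
have r1 := ltW r0; have W1 := ltW W0.
apply: addr_ge0; first by rewrite mulr_ge0 ?sqr_ge0// mulr_ge0.
by apply: mulr_ge0; [exact: mulr_ge0 (sqr_ge0 _) _|rewrite addr_ge0 ?sqr_ge0// mulr_ge0].
Qed.

Lemma measurable_log_ratio_line n (mu x : 'cV[R]_n) (sigma : R) :
  measurable_fun setT (fun z : n.-tuple R * R =>
    (expR (log_ratio mu (z.2 *: x) sigma z.1))%:E).
Proof.
apply/measurable_EFinP/measurableT_comp => //.
under eq_fun do rewrite log_ratioZ.
apply: measurable_funB.
  apply: measurable_funM => //; apply: measurable_sum => i.
  do 2 apply: measurable_funM => //; apply: measurable_funB => //.
  exact: (measurableT_comp (measurable_tnth i) measurable_fst).
by do 2 apply: measurable_funM => //; exact: measurable_funX.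
Qed.

(** Exchanging the amplitude t and the observation y turns the averaged risk
    into an average over y of posterior risks. *)
Lemma integral_normal_gaussianC n (mu x : 'cV[R]_n) (sigma tau : R)
    (F : R -> n.-tuple R -> \bar R) :
  measurable_fun setT (fun z : R * n.-tuple R => F z.1 z.2) ->
  (forall t y, 0 <= F t y) ->
  \int[normal_law 0%R tau]_t \int[gaussian mu sigma]_y
    ((expR (log_ratio mu (t *: x) sigma y))%:E * F t y) =
  \int[gaussian mu sigma]_y \int[normal_law 0%R tau]_t
    ((expR (log_ratio mu (t *: x) sigma y))%:E * F t y).
Proof.
move=> mF F0.
apply: (fubini_tonelli (fun z : R * n.-tuple R =>
  (expR (log_ratio mu (z.1 *: x) sigma z.2))%:E * F z.1 z.2)).
  apply: emeasurable_funM => //.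
  exact: (measurableT_comp (measurable_log_ratio_line mu x sigma)
    (@measurable_swap _ _ R (n.-tuple R))).
by move=> z; rewrite mule_ge0// lee_fin expR_ge0.
Qed.

(** Here a y estimates a quantity that is t under the shifted law and 0 under
    the unshifted one, the latter having relative weight W.  When W dominates the
    second moment of the likelihood ratio, this ratio is at most of order W on most
    of the mass of the shifted law, so a fails for one of the two laws. *)
Lemma gaussian_two_point n (mu h : 'cV[R]_n) (sigma t W : R) (a : n.-tuple R -> R) :
  (0 < sigma)%R -> (0 < W)%R -> measurable_fun setT a ->
  (expR (norm2 h ^+ 2 / sigma ^+ 2) <= 2 * W)%R ->
  (t ^+ 2 / 4)%:E <= \int[gaussian (mu + h)%R sigma]_y ((a y - t) ^+ 2)%:E
     + W%:E * \int[gaussian mu sigma]_y (a y ^+ 2)%:E.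
Proof.
move=> s0 W0 ma hW.
have ma2 : measurable_fun setT (fun y => (a y ^+ 2)%:E).
  by apply/measurable_EFinP; exact: measurable_funX.
have mat : measurable_fun setT (fun y => ((a y - t) ^+ 2)%:E).
  by apply/measurable_EFinP/measurable_funX; exact: measurable_funB.
have mr := measurable_expR_log_ratio mu h sigma.
have mr2 : measurable_fun setT (fun y => (expR (log_ratio mu h sigma y) ^+ 2)%:E).
  by apply/measurable_EFinP/measurable_funX; apply/measurable_EFinP.
rewrite integral_gaussian_shift//; last by move=> y; rewrite lee_fin sqr_ge0.
set r := fun y => expR (log_ratio mu h sigma y) in mr mr2 *.
have r0 y : (0 < r y)%R by exact: expR_gt0.
set A := \int[_]_y (_ * _); set B := \int[_]_y _.
(* The negative term of the lower bound is moved to the side where all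
   integrands are nonnegative. *)
suff : (t ^+ 2 / 2)%:E <= A + W%:E * B + (t ^+ 2 / (8 * W))%:E *
    (expR (norm2 h ^+ 2 / sigma ^+ 2))%:E.
  move=> H; rewrite -leeBlDr// in H.
  apply: le_trans H; rewrite -EFinM -EFinB lee_fin.
  have -> : (t ^+ 2 / 4 = t ^+ 2 / 2 - t ^+ 2 / (8 * W) * (2 * W))%R.
    by field; rewrite gt_eqF.
  rewrite lerB// ler_wpM2l// divr_ge0 ?sqr_ge0// mulr_ge0// ltW//.
rewrite -(integral_gaussian_ratio_sq mu)// -ge0_integralZl//; first last.
- by rewrite lee_fin ltW.
- by move=> y _; rewrite lee_fin sqr_ge0.
rewrite -ge0_integralZl//; first last.
- by rewrite lee_fin divr_ge0 ?sqr_ge0// mulr_ge0// ltW.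
rewrite -ge0_integralD//; first last.
- exact: emeasurable_funM.
- by move=> y _; rewrite mule_ge0// lee_fin ?sqr_ge0// ltW.
- exact: emeasurable_funM.
- by move=> y _; rewrite mule_ge0// lee_fin ?sqr_ge0// ltW.
rewrite -ge0_integralD//; first last.
- exact: emeasurable_funM.
- by move=> y _; rewrite mule_ge0// lee_fin ?sqr_ge0// ?divr_ge0 ?sqr_ge0// mulr_ge0// ltW.
- by apply: emeasurable_funD; exact: emeasurable_funM.
- by move=> y _; rewrite adde_ge0// mule_ge0// lee_fin ?sqr_ge0// ltW.
rewrite -[X in X <= _]mule1 -(integral_gaussian_ratio mu h s0) -ge0_integralZl//; first last.
- by rewrite lee_fin divr_ge0 ?sqr_ge0.
apply: ge0_le_integral => //.
- by move=> y _; rewrite mule_ge0// lee_fin ?expR_ge0// divr_ge0 ?sqr_ge0.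
- exact: emeasurable_funM.
- apply: emeasurable_funD; last exact: emeasurable_funM.
  by apply: emeasurable_funD; exact: emeasurable_funM.
move=> y _; rewrite -!EFinM -!EFinD lee_fin -/(r y).
exact: two_point_ineq.
Qed.

(** For fixed y, the likelihood ratio averaged over t is, by the tilting
    identity, r / tau times the exponential of a square: the random amplitude loses
    at most the factor r / tau, at every y. *)
Lemma normal_mixture_ge n (mu x : 'cV[R]_n) (sigma tau : R) (g : n.-tuple R -> \bar R) :
  (0 < sigma)%R -> (0 < tau)%R -> measurable_fun setT g -> (forall y, 0 <= g y) ->
  ((Num.sqrt (1 + tau ^+ 2 * (norm2 x ^+ 2 / sigma ^+ 2)))^-1)%:E *
    \int[gaussian mu sigma]_y g y <=
  \int[normal_law 0%R tau]_t \int[gaussian (mu + t *: x)%R sigma]_y g y.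
Proof.
move=> s0 t0 mg g0.
under [leRHS]eq_integral do rewrite integral_gaussian_shift//.
rewrite (integral_normal_gaussianC mu x sigma tau (F := fun _ => g))//; last first.
  exact: (measurableT_comp mg measurable_snd).
rewrite -ge0_integralZl//.
apply: ge0_le_integral => //.
- by move=> y _; rewrite mule_ge0// lee_fin invr_ge0 sqrtr_ge0.
- exact: emeasurable_funM.
- apply: (@measurable_fun_fubini_tonelli_F _ _ _ _ _ (normal_law 0 tau)
    (fun z : n.-tuple R * R => (expR (log_ratio mu (z.2 *: x) sigma z.1))%:E * g z.1)).
    apply: emeasurable_funM; last exact: (measurableT_comp mg measurable_fst).
    exact: measurable_log_ratio_line.
  by move=> z; rewrite mule_ge0// lee_fin expR_ge0.
move=> y _.
under eq_integral do rewrite log_ratioZ.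
rewrite (@integral_normal_law_tilt _ tau _ _ (cst (g y)))//; first last.
- by move=> z; exact: g0.
- by rewrite divr_ge0 ?sqr_ge0.
rewrite integral_probability_cst lee_wpmul2r// lee_fin.
rewrite [(tau / _ / tau)%R]mulrAC divff ?gt_eqF// mul1r ler_peMr ?invr_ge0 ?sqrtr_ge0//.
by rewrite -expR0 ler_expR mulr_ge0// mulr_ge0// sqr_ge0.
Qed.

(** Given y the amplitude is normal with a variance that does not depend on y,
    and normal_law_mse_ge bounds the posterior risk of the guess a y. *)
Lemma normal_mse_gaussian_ge n (mu x : 'cV[R]_n) (sigma tau : R) (a : n.-tuple R -> R) :
  (0 < sigma)%R -> (0 < tau)%R -> measurable_fun setT a ->
  (normal_itv_mass R * (tau ^+ 2 / (1 + tau ^+ 2 * (norm2 x ^+ 2 / sigma ^+ 2))))%:E <=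
  \int[normal_law 0%R tau]_t
    \int[gaussian (mu + t *: x)%R sigma]_y ((a y - t) ^+ 2)%:E.
Proof.
move=> s0 t0 ma.
set v := (norm2 x ^+ 2 / sigma ^+ 2)%R.
have v0 : (0 <= v)%R by rewrite divr_ge0 ?sqr_ge0.
have q0 : (0 < 1 + tau ^+ 2 * v)%R by rewrite ltr_pwDl// mulr_ge0// sqr_ge0.
have c0 : (0 <= normal_itv_mass R * (tau ^+ 2 / (1 + tau ^+ 2 * v)))%R.
  apply: mulr_ge0; first exact/ltW/normal_itv_mass_gt0.
  by apply: divr_ge0; [exact: sqr_ge0|exact: ltW].
have mat : measurable_fun setT (fun z : R * n.-tuple R => ((a z.2 - z.1) ^+ 2)%:E).
  apply/measurable_EFinP/measurable_funX; apply: measurable_funB => //.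
  exact: (measurableT_comp ma measurable_snd).
have mat' : measurable_fun setT (fun z : n.-tuple R * R => ((a z.1 - z.2) ^+ 2)%:E).
  apply/measurable_EFinP/measurable_funX; apply: measurable_funB => //.
  exact: (measurableT_comp ma measurable_fst).
have ge0 z : 0 <= ((a z.2 - z.1) ^+ 2)%:E by rewrite lee_fin sqr_ge0.
under [leRHS]eq_integral => t _.
  rewrite integral_gaussian_shift//; first over.
  - exact: (measurableT_comp mat (pair1_measurable t)).
  - by move=> y; exact: (ge0 (t, y)).
rewrite (integral_normal_gaussianC mu x sigma tau
  (F := fun t y => ((a y - t) ^+ 2)%:E))//; last first.
  by move=> t y; exact: (ge0 (t, y)).
rewrite -[leLHS]mule1.
have <- : \int[normal_law 0%R tau]_t
    \int[gaussian mu sigma]_y ((expR (log_ratio mu (t *: x) sigma y))%:E * 1) = 1.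
  under eq_integral => t _.
    under eq_integral do rewrite mule1.
    rewrite integral_gaussian_ratio//; over.
  exact: integral_probability_cst.
rewrite (integral_normal_gaussianC mu x sigma tau (F := fun _ _ => 1))//.
have mF (F : R -> n.-tuple R -> \bar R) :
    measurable_fun setT (fun z : n.-tuple R * R => F z.2 z.1) ->
    (forall t y, 0 <= F t y) -> measurable_fun setT (fun y => \int[normal_law 0%R tau]_t
    ((expR (log_ratio mu (t *: x) sigma y))%:E * F t y)).
  move=> mF0 F0.
  apply: (@measurable_fun_fubini_tonelli_F _ _ _ _ _ (normal_law 0 tau)
    (fun z : n.-tuple R * R => (expR (log_ratio mu (z.2 *: x) sigma z.1))%:E * F z.2 z.1)).
    by apply: emeasurable_funM => //; exact: measurable_log_ratio_line.
  by move=> z; rewrite mule_ge0// lee_fin expR_ge0.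
rewrite -ge0_integralZl//; first last.
- by move=> y _; apply: integral_ge0 => t _; rewrite mule1 lee_fin expR_ge0.
- exact: mF.
apply: ge0_le_integral => //.
- move=> y _; apply: mule_ge0; first by rewrite lee_fin.
  by apply: integral_ge0 => t _; rewrite mule1 lee_fin expR_ge0.
- by apply: emeasurable_funM => //; exact: mF.
- by apply: mF => // t y; exact: (ge0 (t, y)).
move=> y _.
under eq_integral do rewrite log_ratioZ.
under [leRHS]eq_integral do rewrite log_ratioZ.
rewrite (@integral_normal_law_tilt _ tau _ _ (cst 1))// integral_probability_cst mule1.
rewrite (@integral_normal_law_tilt _ tau _ _ (fun t => ((a y - t) ^+ 2)%:E))//; first last.
- by move=> t; exact: (ge0 (t, y)).
- exact: (measurableT_comp mat' (pair1_measurable y)).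
rewrite muleC lee_wpmul2l//.
  by rewrite lee_fin mulr_ge0 ?expR_ge0// !divr_ge0 ?sqrtr_ge0 ?ltW.
rewrite -/v; have -> : (tau ^+ 2 / (1 + tau ^+ 2 * v) =
    (tau / Num.sqrt (1 + tau ^+ 2 * v)) ^+ 2)%R.
  by rewrite expr_div_n sqr_sqrtr// ltW.
apply: normal_law_mse_ge; by rewrite divr_gt0// sqrtr_gt0.
Qed.
End gaussian.

(** * The prior as a finite mixture *)

Section prior.
Local Open Scope ereal_scope.
Context (R : realType).

Lemma measurable_mulmx_vec n d (X : 'M[R]_(n, d)) i :
  measurable_fun setT (fun theta : d.-tuple R => (X *m vec theta) i 0%R).
Proof.
under eq_fun do rewrite mxE.
apply: measurable_sum => j; apply: measurable_funM => //.
by under eq_fun do rewrite mxE; exact: measurable_tnth.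
Qed.

(** The law of y varies with theta.  Written as a density against the fixed law
    N(0, sigma^2 I), the integral becomes one to which Tonelli applies. *)
Lemma measurable_integral_gaussian n d (X : 'M[R]_(n, d)) (sigma : R)
    (F : d.-tuple R * n.-tuple R -> \bar R) : (0 < sigma)%R ->
  measurable_fun setT F -> (forall z, 0 <= F z) ->
  measurable_fun setT (fun theta =>
    \int[gaussian (X *m vec theta) sigma]_y F (theta, y)).
Proof.
move=> s0 mF F0.
have FE theta : \int[gaussian (X *m vec theta) sigma]_y F (theta, y) =
    \int[gaussian 0%R sigma]_y
      ((expR (log_ratio 0%R (X *m vec theta) sigma y))%:E * F (theta, y)).
  have mFt := measurableT_comp mF (pair1_measurable theta).
  by have := integral_gaussian_shift 0%R (X *m vec theta) s0 mFt (fun y => F0 (theta, y));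
    rewrite add0r.
under eq_fun do rewrite FE.
apply: (@measurable_fun_fubini_tonelli_F _ _ _ _ _ (gaussian 0%R sigma)
  (fun z => (expR (log_ratio 0%R (X *m vec z.1) sigma z.2))%:E * F (z.1, z.2))); last first.
  by move=> z; rewrite mule_ge0// lee_fin expR_ge0.
apply: emeasurable_funM; last by under eq_fun do rewrite -surjective_pairing.
apply/measurable_EFinP/measurableT_comp => //.
apply: measurable_sum => i.
have mX := measurableT_comp (measurable_mulmx_vec X i)
  (@measurable_fst _ _ (d.-tuple R) (n.-tuple R)).
apply: measurable_funB.
  do 2 apply: measurable_funM => //; apply: measurable_funB => //.
  exact: (measurableT_comp (measurable_tnth i) measurable_snd).
by do 2 apply: measurable_funM => //; exact: measurable_funX.
Qed.

(** Enumerating the supports presents the mixture as a scaled finite sum of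
    measures. *)
Lemma integral_prior d k (tau : R) (g : d.-tuple R -> \bar R) :
  measurable_fun setT g -> (forall x, 0 <= g x) ->
  \int[prior d k tau]_theta g theta = ('C(d, k)%:R^-1)%:E *
    \sum_(K : {set 'I_d} | #|K| == k) \int[product_law (prior_coord tau K)]_theta g theta.
Proof.
move=> mg g0.
pose s := enum [pred K : {set 'I_d} | #|K| == k].
pose m_ (i : nat) : {measure set (d.-tuple R) -> \bar R} :=
  product_law (prior_coord tau (nth finset.set0 s i)).
have sumE (h : {set 'I_d} -> \bar R) :
    \sum_(K : {set 'I_d} | #|K| == k) h K = \sum_(i < size s) h (nth finset.set0 s i).
  by rewrite -big_enum (big_nth finset.set0) big_mkord.
have c0 : (0 <= 'C(d, k)%:R^-1 :> R)%R by rewrite invr_ge0.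
rewrite sumE -(ge0_integral_measure_sum m_)//.
rewrite -[X in X%:E * _]/((NngNum c0)%:num) -ge0_integral_mscale//.
apply: eq_measure_integral => A mA _.
exact: (congr1 (fun z => ('C(d, k)%:R^-1)%:E * z)
  (sumE (fun K => product_law (prior_coord tau K) A))).
Qed.

Lemma measurable_sparse_vectors d k : measurable (@sparse_vectors R d k).
Proof.
(* The number of nonzero coordinates, as a measurable real function. *)
pose f (theta : d.-tuple R) : R := (\sum_i \1_(~` [set 0%R]) (tnth theta i))%R.
have mf : measurable_fun setT f.
  apply: measurable_sum => i; apply: measurableT_comp; last exact: measurable_tnth.
  by apply: measurable_indic; exact: measurableC.
rewrite (_ : sparse_vectors d k = setT `&` f @^-1` `]-oo, k%:R]%classic); last first.
  apply/funext => theta; apply/propext; rewrite setTI /sparse_vectors /= in_itv/=.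
  rewrite -(ler_nat R) /norm0 -sum1_card natr_sum big_mkcond /f.
  rewrite (eq_bigr (fun i => \1_(~` [set 0%R]) (tnth theta i)))// => i _.
  rewrite inE mxE indicE; case: eqP => [->|/eqP ti]; first by rewrite memNset//=; exact.
  by rewrite mem_set//=; exact/eqP.
by apply: mf => //; exact: measurable_itv.
Qed.

(** Off the support the coordinates are 0 almost surely: for each K, the
    product law is concentrated on a box contained in the sparse vectors. *)
Lemma prior_sparse d k (tau : R) : prior d k tau (~` sparse_vectors d k) = 0.
Proof.
rewrite /prior big1 ?mule0// => K /eqP Kk.
pose A (i : 'I_d) : set R := if i \in K then setT else [set 0%R].
have mA i : measurable (A i) by rewrite /A; case: ifP.
have B1 : product_law (prior_coord tau K) [set t | forall i, A i (tnth t i)] = 1.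
  rewrite product_lawE// big1// => i _; rewrite /A /prior_coord.
  case: ifP => _; first exact: probability_setT.
  by rewrite -[LHS]/(\d_(0%R : R) [set (0%R : R)] : \bar R) diracE mem_set.
have mB : measurable [set t : d.-tuple R | forall i, A i (tnth t i)].
  rewrite (_ : [set _ | _] =
      \big[setI/setT]_(i < d) ((@tnth d R)^~ i @^-1` A i)).
    apply: bigsetI_measurable => i _; rewrite -[X in measurable X]setTI.
    exact: measurable_tnth.
  rewrite -bigcap_seq; apply/seteqP; split => t /= H i; first by move=> _; exact: H.
  by apply: (H i); rewrite /= mem_index_enum.
have mT := @measurable_sparse_vectors d k.
apply/eqP; rewrite eq_le measure_ge0 andbT.
have <- : product_law (prior_coord tau K) (~` [set t | forall i, A i (tnth t i)]) = 0.
  by rewrite probability_setC// B1 subee.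
apply: le_measure; rewrite ?inE; [exact: measurableC|exact: measurableC|].
apply: subsetC => t /= Bt; rewrite /sparse_vectors/= -Kk /norm0.
apply/subset_leq_card/fintype.subsetP => i; rewrite inE mxE.
by have := Bt i; rewrite /A; case: (i \in K) => //= ->; rewrite eqxx.
Qed.

Lemma integral_prior_sparse d k (tau : R) (g : d.-tuple R -> \bar R) :
  measurable_fun setT g -> (forall x, 0 <= g x) ->
  \int[prior d k tau]_(theta in sparse_vectors d k) g theta =
  \int[prior d k tau]_theta g theta.
Proof.
move=> mg g0.
rewrite (@ge0_negligible_integral _ _ _ _ setT (~` sparse_vectors d k))//.
- by rewrite setDE setCK setTI.
- by apply: measurableC; exact: (@measurable_sparse_vectors d k).
- exact: prior_sparse.
Qed.
End prior.

(** * Risk of one coordinate for a given support *)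

Section coordinate_risk.
Local Open Scope ereal_scope.
Context (R : realType) (n d : nat) (X : 'M[R]_(n, d)) (sigma tau : R).
Hypotheses (sigma0 : (0 < sigma)%R) (tau0 : (0 < tau)%R).
Context (b : n.-tuple R -> R) (mb : measurable_fun setT b) (j : 'I_d).

Definition coord_loss (theta : d.-tuple R) : \bar R :=
  \int[gaussian (X *m vec theta) sigma]_y ((b y - tnth theta j) ^+ 2)%:E.

Definition coord_risk (K : {set 'I_d}) : \bar R :=
  \int[product_law (prior_coord tau K)]_theta coord_loss theta.

Lemma measurable_coord_loss : measurable_fun setT coord_loss.
Proof.
apply: (@measurable_integral_gaussian _ _ _ X sigma
  (fun z => ((b z.2 - tnth z.1 j) ^+ 2)%:E)) => //; last first.
  by move=> z; rewrite lee_fin sqr_ge0.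
apply/measurable_EFinP/measurable_funX; apply: measurable_funB.
  exact: (measurableT_comp mb measurable_snd).
exact: (measurableT_comp (measurable_tnth j) measurable_fst).
Qed.

Lemma coord_loss_ge0 theta : 0 <= coord_loss theta.
Proof. by apply: integral_ge0 => y _; rewrite lee_fin sqr_ge0. Qed.

Lemma coord_risk_ge0 K : 0 <= coord_risk K.
Proof. by apply: integral_ge0 => y _; exact: coord_loss_ge0. Qed.

Lemma mulmx_vec_add_coord i theta t :
  (X *m vec (add_coord i theta t) = X *m vec theta + t *: col i X)%R.
Proof.
rewrite (_ : vec (add_coord i theta t) = vec theta + t *: delta_mx i 0)%R.
  by rewrite mulmxDr -scalemxAr colE.
apply/matrixP => l c; rewrite !mxE tnth_mktuple ord1 eqxx andbT.
by case: eqP => _; rewrite ?mulr1 ?mulr0.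
Qed.

Definition added_loss i theta : \bar R :=
  \int[normal_law 0%R tau]_t coord_loss (add_coord i theta t).

Lemma measurable_added_loss i : measurable_fun setT (added_loss i).
Proof.
apply: (measurable_fun_fubini_tonelli_F
  (fun z : d.-tuple R * R => coord_loss (add_coord i z.1 z.2))).
  apply: measurableT_comp; first exact: measurable_coord_loss.
  exact: measurable_add_coord.
by move=> z; exact: coord_loss_ge0.
Qed.

Lemma added_loss_ge0 i theta : 0 <= added_loss i theta.
Proof. by apply: integral_ge0 => t _; exact: coord_loss_ge0. Qed.

Lemma coord_risk_setU1 i (K : {set 'I_d}) : i \notin K ->
  coord_risk (i |: K) =
  \int[product_law (prior_coord tau K)]_theta added_loss i theta.
Proof.
move=> iK; apply: integral_product_law_insert.
- by rewrite /prior_coord (negbTE iK).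
- by rewrite /prior_coord setU11.
- by move=> l li; rewrite /prior_coord in_setU1 (negbTE li).
- exact: measurable_coord_loss.
- exact: coord_loss_ge0.
Qed.

(** Since the estimator is arbitrary, the old value of theta_j is absorbed in it,
    and the added amplitude t is what remains to be estimated. *)
Lemma coord_loss_add_self theta t :
  coord_loss (add_coord j theta t) =
  \int[gaussian (X *m vec theta + t *: col j X)%R sigma]_y
    ((b y - tnth theta j - t) ^+ 2)%:E.
Proof.
rewrite /coord_loss mulmx_vec_add_coord; apply: eq_integral => y _.
by rewrite tnth_mktuple eqxx opprD addrA.
Qed.

Lemma coord_loss_add_other i theta t : i != j ->
  coord_loss (add_coord i theta t) =
  \int[gaussian (X *m vec theta + t *: col i X)%R sigma]_y
    ((b y - tnth theta j) ^+ 2)%:E.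
Proof.
move=> ij; rewrite /coord_loss mulmx_vec_add_coord; apply: eq_integral => y _.
by rewrite tnth_mktuple eq_sym (negbTE ij) addr0.
Qed.

Variable s : R.
Hypothesis snr : forall i,
  (tau ^+ 2 * (norm2 (col i X) ^+ 2 / sigma ^+ 2) <= s)%R.

Let snr_ge0 i : (0 <= norm2 (col i X) ^+ 2 / sigma ^+ 2)%R.
Proof. by apply: divr_ge0; exact: sqr_ge0. Qed.

Let s_ge0 : (0 <= s)%R.
Proof.
by apply: le_trans (snr j); apply: mulr_ge0; [exact: sqr_ge0|exact: snr_ge0].
Qed.

Let mbj theta : measurable_fun setT (fun y => (b y - tnth theta j)%R).
Proof. exact: measurable_funB. Qed.

(** The risk averages, over everything but the amplitude of the spike at j, the
    risk of estimating that amplitude. *)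
Lemma coord_risk_oracle (K : {set 'I_d}) : j \notin K ->
  (normal_itv_mass R * (tau ^+ 2 / (1 + s)))%:E <= coord_risk (j |: K).
Proof.
move=> jK; rewrite coord_risk_setU1//.
rewrite -[leLHS](integral_probability_cst (product_law (prior_coord tau K))).
have c0 : (0 <= normal_itv_mass R * (tau ^+ 2 / (1 + s)))%R.
  apply: mulr_ge0; first exact/ltW/normal_itv_mass_gt0.
  by apply: divr_ge0; [exact: sqr_ge0|rewrite addr_ge0].
apply: ge0_le_integral => //.
- exact: measurable_added_loss.
move=> theta _; rewrite /added_loss.
under eq_integral do rewrite coord_loss_add_self.
apply: le_trans (normal_mse_gaussian_ge (X *m vec theta) (col j X) sigma0 tau0 (mbj theta)).
rewrite lee_fin ler_wpM2l//; first exact/ltW/normal_itv_mass_gt0.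
have v0 := snr_ge0 j.
rewrite ler_wpM2l ?sqr_ge0// lef_pV2 ?posrE ?ltr_pwDl// ?lerD2l ?snr//.
by rewrite mulr_ge0// sqr_ge0.
Qed.

(** A spike at i leaves theta_j unchanged and only perturbs the law of y, which
    normal_mixture_ge compares with the law without that spike. *)
Lemma coord_risk_other i (K : {set 'I_d}) : i \notin K -> i != j ->
  ((Num.sqrt (1 + s))^-1)%:E * coord_risk K <= coord_risk (i |: K).
Proof.
move=> iK ij; rewrite coord_risk_setU1//.
have q0 : (0 < 1 + s)%R by rewrite ltr_pwDl.
have c0 : (0 <= (Num.sqrt (1 + s))^-1)%R by rewrite invr_ge0 sqrtr_ge0.
have mL := measurable_coord_loss.
rewrite /coord_risk -ge0_integralZl//; last by move=> theta _; exact: coord_loss_ge0.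
apply: ge0_le_integral => //.
- by move=> theta _; rewrite mule_ge0// coord_loss_ge0.
- exact: emeasurable_funM.
- exact: measurable_added_loss.
move=> theta _; rewrite /added_loss.
under eq_integral do rewrite coord_loss_add_other//.
apply: le_trans (normal_mixture_ge (X *m vec theta) (col i X) sigma0 tau0 _ _).
- rewrite lee_wpmul2r ?coord_loss_ge0// lee_fin.
  have v0 : (0 <= tau ^+ 2 * (norm2 (col i X) ^+ 2 / sigma ^+ 2))%R.
    by apply: mulr_ge0; [exact: sqr_ge0|exact: snr_ge0].
  rewrite lef_pV2 ?posrE ?sqrtr_gt0 ?ltr_pwDl//.
  by rewrite ler_wsqrtr// lerD2l.
- by apply/measurable_EFinP/measurable_funX; exact: mbj.
- by move=> y; rewrite lee_fin sqr_ge0.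
Qed.

(** With or without a spike at j: the amplitudes in [tau, 2 tau] have a mass
    bounded below, and for these the two laws of y are close enough, in the sense
    of gaussian_two_point, for the estimation of theta_j to fail under one of
    them. *)
Lemma coord_risk_pair (W : R) (K : {set 'I_d}) : (0 < W)%R ->
  (expR (4 * s) <= 2 * W)%R -> j \notin K ->
  (normal_itv_mass R * (tau ^+ 2 / 4))%:E <= coord_risk (j |: K) + W%:E * coord_risk K.
Proof.
move=> W0 sW jK; rewrite coord_risk_setU1//.
rewrite -[leLHS](integral_probability_cst (product_law (prior_coord tau K))).
have c0 : (0 <= normal_itv_mass R * (tau ^+ 2 / 4))%R.
  apply: mulr_ge0; first exact/ltW/normal_itv_mass_gt0.
  by apply: divr_ge0; [exact: sqr_ge0|].
have mL := measurable_coord_loss.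
have mA := measurable_added_loss j.
rewrite /coord_risk -ge0_integralZl//; first last.
- by rewrite lee_fin ltW.
- by move=> theta _; exact: coord_loss_ge0.
rewrite -ge0_integralD//; first last.
- exact: emeasurable_funM.
- by move=> theta _; rewrite mule_ge0 ?coord_loss_ge0// lee_fin ltW.
- by move=> theta _; exact: added_loss_ge0.
apply: ge0_le_integral => //.
- by apply: emeasurable_funD => //; exact: emeasurable_funM.
move=> theta _.
set l := coord_loss theta; have l0 : 0 <= W%:E * l.
  by rewrite mule_ge0 ?coord_loss_ge0// lee_fin ltW.
rewrite -(integral_probability_cst (normal_law 0%R tau) (W%:E * l)) /added_loss.
have mLt : measurable_fun setT (fun t => coord_loss (add_coord j theta t)).
  apply: measurableT_comp => //.
  exact: (measurableT_comp (measurable_add_coord j) (pair1_measurable theta)).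
rewrite -ge0_integralD//; last by move=> t _; exact: coord_loss_ge0.
have mI : measurable `[tau, (tau + tau)%R]%classic by exact: measurable_itv.
have mS : measurable_fun setT (fun t => coord_loss (add_coord j theta t) + W%:E * l).
  exact: emeasurable_funD.
apply: le_trans (ge0_subset_integral _ mI measurableT mS _ _) => //; last first.
  by move=> t _; rewrite adde_ge0// coord_loss_ge0.
apply: (@le_trans _ _ (\int[normal_law 0%R tau]_(t in `[tau, (tau + tau)%R])
    (tau ^+ 2 / 4)%:E)).
  rewrite integral_cst//= EFinM muleC lee_pmul2l//; last by rewrite lte_fin divr_gt0// exprn_gt0.
  by apply: normal_law_itv_ge => //; have := tau0; lra.
apply: ge0_le_integral => //.
- by move=> t _; rewrite lee_fin divr_ge0// sqr_ge0.
- exact: measurable_funTS.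
move=> t /=; rewrite in_itv/= => /andP[t1 t2].
rewrite coord_loss_add_self.
apply: le_trans (@gaussian_two_point _ _ (X *m vec theta) (t *: col j X) _ t _ _ sigma0 W0 (mbj theta) _).
  by rewrite lee_fin ler_wpM2r// lerXn2r// ?nnegrE ltW// (lt_le_trans tau0).
apply: le_trans sW; rewrite ler_expR.
have -> : (norm2 (t *: col j X) ^+ 2 = t ^+ 2 * norm2 (col j X) ^+ 2)%R.
  by rewrite !norm2_sq mulr_sumr; apply: eq_bigr => i _; rewrite !mxE exprMn.
rewrite -mulrA; apply: (@le_trans _ _ (4 * (tau ^+ 2 * (norm2 (col j X) ^+ 2 / sigma ^+ 2)))%R).
  rewrite [leRHS]mulrA ler_wpM2r// ?snr_ge0//.
  have := tau0; nra.
by rewrite ler_wpM2l.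
Qed.
End coordinate_risk.

(** * Averaging over the supports *)

Section supports.
Local Open Scope ereal_scope.
Context (R : realType) (d k : nat).
Implicit Types (S K : {set 'I_d}).

Lemma sume_card (I : finType) (A : {pred I}) (x : \bar R) :
  \sum_(i in A) x = #|A|%:R%:E * x.
Proof.
rewrite -sumr_const -sumEFin ge0_sume_distrl//.
by apply: eq_bigr => i _; rewrite mul1e.
Qed.

(** Moving the spike of K from j to i gives a support S that avoids j and
    contains i; moving it back from i to j recovers K. *)
Lemma sum_exchange_support (j : 'I_d) (f : {set 'I_d} -> \bar R) :
  \sum_(S : {set 'I_d} | (#|S| == k) && (j \notin S)) \sum_(i in S) f S =
  \sum_(K : {set 'I_d} | (#|K| == k) && (j \in K))
    \sum_(i | i \notin K) f (i |: (K :\ j)).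
Proof.
rewrite pair_big_dep [RHS]pair_big_dep/=.
rewrite (reindex_onto
  (fun p : {set 'I_d} * 'I_d => (p.2 |: (p.1 :\ j), p.2))
  (fun p : {set 'I_d} * 'I_d => (j |: (p.1 :\ p.2), p.2)))/=; last first.
  move=> [S i]/= /andP[/andP[_ jS] iS]; congr pair.
  have ij : i != j by apply: contraNneq jS => <-.
  apply/setP => l; rewrite !inE.
  case: (eqVneq l i) => [->|li]; first by rewrite iS.
  by case: (eqVneq l j) => [->|lj] //=; rewrite (negbTE jS).
apply: eq_bigl => -[K i]/=; rewrite setU11 andbT xpair_eqE eqxx andbT.
have jE : (j \notin i |: K :\ j) = (i != j) by rewrite !inE eqxx orbF eq_sym.
rewrite jE; apply/andP/andP.
- move=> [/andP[cK ij] /eqP E].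
  have jK : j \in K by rewrite -E setU11.
  have iK : i \notin K by rewrite -E !inE eqxx (negbTE ij).
  by rewrite jK iK -(eqP cK) cardsU1 !inE (negbTE iK) andbF (cardsD1 j K) jK eqxx; split.
- move=> [/andP[cK jK] iK].
  have ij : i != j by apply: contraNneq iK => ->.
  rewrite cardsU1 !inE (negbTE iK) andbF -(eqP cK) (cardsD1 j K) jK eqxx/=.
  rewrite ij; split=> //.
  apply/eqP/setP => l; rewrite !inE.
  case: (eqVneq l j) => [->|lj] //=.
  by case: (eqVneq l i) => [->|li] //=; rewrite (negbTE iK).
Qed.

(** The risk f S of a support S that misses j is cut into k equal shares, one for
    each i in S, and the share of i goes to the support that has j in place of i.
    A support K containing j then collects d - k shares, each at least q / k times
    the risk of K without j, and these compensate what f K may lack. *)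
Lemma sum_support_ge (j : 'I_d) (f : {set 'I_d} -> \bar R) (c q : R) :
  (0 < k)%N -> (k <= d)%N -> (0 <= q)%R -> (forall K, 0 <= f K) ->
  (forall K, j \notin K -> c%:E <= f (j |: K) + ((d - k)%:R / k%:R * q)%:E * f K) ->
  (forall K i, i \notin K -> i != j -> q%:E * f K <= f (i |: K)) ->
  \sum_(K : {set 'I_d} | (#|K| == k) && (j \in K)) c%:E <=
  \sum_(K : {set 'I_d} | #|K| == k) f K.
Proof.
move=> k0 kd q0 f0 fj fi.
have kn : (k%:R != 0 :> R)%R by rewrite pnatr_eq0 -lt0n.
have rest : \sum_(K : {set 'I_d} | (#|K| == k) && (j \in K))
    ((d - k)%:R / k%:R * q)%:E * f (K :\ j) <=
    \sum_(S : {set 'I_d} | (#|S| == k) && (j \notin S)) f S.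
  have -> : \sum_(S : {set 'I_d} | (#|S| == k) && (j \notin S)) f S =
      (k%:R^-1)%:E * \sum_(S : {set 'I_d} | (#|S| == k) && (j \notin S)) \sum_(i in S) f S.
    rewrite ge0_sume_distrr; last by move=> S _; exact: sume_ge0.
    apply: eq_bigr => S /andP[/eqP Sk _]; rewrite sume_card Sk muleA.
    by rewrite -EFinM mulVf// mul1e.
  rewrite sum_exchange_support ge0_sume_distrr; last by move=> K _; exact: sume_ge0.
  apply: lee_sum => K /andP[/eqP Kk jK].
  apply: (@le_trans _ _ ((k%:R^-1)%:E * \sum_(i | i \notin K) (q%:E * f (K :\ j)))).
    rewrite (sume_card (fun i => i \notin K)).
    have -> : #|(fun i : 'I_d => i \notin K)| = (d - k)%N.
      have /eqP := cardC [in K]; rewrite card_ord Kk -[X in _ == X](subnKC kd) eqn_add2l.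
      by move=> /eqP <-; apply: eq_card => i; rewrite !inE.
    rewrite !muleA -!EFinM; apply: lee_wpmul2r; first exact: f0.
    by rewrite lee_fin [(k%:R^-1 * _)%R]mulrC.
  apply: lee_wpmul2l; first by rewrite lee_fin invr_ge0.
  apply: lee_sum => i iK; apply: fi; first by rewrite !inE (negbTE iK) andbF.
  by apply: contraNneq iK => ->.
rewrite [leRHS](bigID (fun K : {set 'I_d} => j \in K))/=.
apply: le_trans (leeD (lexx _) rest); rewrite -big_split/=.
apply: lee_sum => K /andP[_ jK]; rewrite -[in f K](finset.setD1K jK).
by apply: fj; rewrite finset.setD11.
Qed.

Lemma sum_support_count (c : R) : (k <= d)%N ->
  \sum_(j < d) \sum_(K : {set 'I_d} | (#|K| == k) && (j \in K)) c%:E =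
  (('C(d, k))%:R * (k%:R * c))%:E.
Proof.
move=> kd; rewrite (exchange_big_dep (fun K : {set 'I_d} => #|K| == k))/=; last first.
  by move=> j K _ /andP[].
rewrite (eq_bigr (fun=> (k%:R * c)%:E)); last first.
  move=> K /eqP Kk; rewrite (eq_bigl (fun j => j \in K)); last first.
    by move=> j; rewrite Kk eqxx.
  by rewrite sume_card Kk.
rewrite sumEFin sumr_const -[X in X%:E = _]mulr_natl; congr ((_%:R * _)%R%:E).
by rewrite -[d in RHS]card_ord -(card_draws 'I_d k) cardsE.
Qed.
End supports.

Section bayes_est.
Local Open Scope ereal_scope.
Context (R : realType) (n d k : nat) (X : 'M[R]_(n, d)) (sigma tau : R).
Hypotheses (sigma0 : (0 < sigma)%R) (tau0 : (0 < tau)%R) (kd : (k <= d)%N).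

Definition est_coord (est : n.-tuple R -> d.-tuple R) (j : 'I_d) y := tnth (est y) j.

Lemma loss_estE (theta theta' : d.-tuple R) :
  loss_est (vec theta) (vec theta') = (\sum_j (tnth theta' j - tnth theta j) ^+ 2)%R.
Proof. by rewrite /loss_est norm2_sq; apply: eq_bigr => i _; rewrite !mxE. Qed.

Lemma measurable_est_coord (est : {mfun n.-tuple R >-> d.-tuple R}) j :
  measurable_fun setT (est_coord est j).
Proof. exact: (measurableT_comp (measurable_tnth j)). Qed.

Lemma est_risk_coord (est : {mfun n.-tuple R >-> d.-tuple R}) :
  \int[prior d k tau]_(theta in sparse_vectors d k)
    \int[gaussian (X *m vec theta) sigma]_y (loss_est (vec theta) (vec (est y)))%:E =
  ('C(d, k)%:R^-1)%:E * \sum_(j < d) \sum_(K : {set 'I_d} | #|K| == k)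
    coord_risk X sigma tau (est_coord est j) j K.
Proof.
have mc j := measurable_coord_loss X sigma0 (measurable_est_coord est j) j.
have E theta : \int[gaussian (X *m vec theta) sigma]_y
    (loss_est (vec theta) (vec (est y)))%:E =
    \sum_(j < d) coord_loss X sigma (est_coord est j) j theta.
  rewrite -ge0_integral_sum//; first last.
  - by move=> j y _; rewrite lee_fin sqr_ge0.
  - move=> j; apply/measurable_EFinP/measurable_funX; apply: measurable_funB => //.
    exact: measurable_est_coord.
  by apply: eq_integral => y _; rewrite loss_estE sumEFin.
under eq_integral do rewrite E.
have ms : measurable_fun setT
    (fun theta => \sum_(j < d) coord_loss X sigma (est_coord est j) j theta).
  by apply: emeasurable_sum.
have s0 theta : 0 <= \sum_(j < d) coord_loss X sigma (est_coord est j) j theta.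
  by apply: sume_ge0 => j _; exact: coord_loss_ge0.
rewrite integral_prior_sparse// integral_prior//; congr (_ * _).
rewrite [RHS]exchange_big/=; apply: eq_bigr => K _.
by rewrite ge0_integral_sum// => j theta _; exact: coord_loss_ge0.
Qed.

(** Each support of size k is counted once for each of its k elements, so a bound
    c per pair of a coordinate and a support containing it yields k * c. *)
Lemma bayes_risk_est_ge (c : R) :
  (forall (est : {mfun n.-tuple R >-> d.-tuple R}) (j : 'I_d),
    \sum_(K : {set 'I_d} | (#|K| == k) && (j \in K)) c%:E <=
    \sum_(K : {set 'I_d} | #|K| == k) coord_risk X sigma tau (est_coord est j) j K) ->
  (k%:R * c)%:E <= bayes_risk X sigma (prior d k tau) loss_est (sparse_vectors d k).
Proof.
move=> H; apply: le_ereal_inf_tmp => _ [est _ <-]; rewrite est_risk_coord.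
have C0 : ('C(d, k)%:R != 0 :> R)%R by rewrite pnatr_eq0 -lt0n bin_gt0.
have -> : (k%:R * c)%:E = ('C(d, k)%:R^-1)%:E *
    \sum_(j < d) \sum_(K : {set 'I_d} | (#|K| == k) && (j \in K)) c%:E.
  by rewrite sum_support_count// -EFinM mulKf.
apply: lee_wpmul2l; first by rewrite lee_fin invr_ge0.
by apply: lee_sum => j _; exact: H.
Qed.

Variable s : R.
Hypothesis snr : forall i,
  (tau ^+ 2 * (norm2 (col i X) ^+ 2 / sigma ^+ 2) <= s)%R.

(** Only the coordinates in the support are charged. *)
Lemma bayes_risk_est_oracle :
  (k%:R * (normal_itv_mass R * (tau ^+ 2 / (1 + s))))%:E <=
  bayes_risk X sigma (prior d k tau) loss_est (sparse_vectors d k).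
Proof.
apply: bayes_risk_est_ge => est j.
rewrite [leRHS](bigID (fun K : {set 'I_d} => j \in K))/=.
rewrite -[leLHS]adde0; apply: leeD; last by apply: sume_ge0 => K _; exact: coord_risk_ge0.
apply: lee_sum => K /andP[_ jK].
rewrite -[in coord_risk _ _ _ _ _ K](finset.setD1K jK); apply: coord_risk_oracle => //.
- exact: measurable_est_coord.
- by rewrite finset.setD11.
Qed.

(** Coordinates outside the support are charged as well: the weight
    (d - k) / k / sqrt (1 + s) that they provide is at least
    exp (12 s) / 2 * exp (- s / 2), well above the exp (4 s) / 2 that coord_risk_pair
    asks for. *)
Lemma bayes_risk_est_sparse : (0 < k)%N -> (2 * k <= d)%N ->
  (0 <= s)%R -> (12 * s <= ln (d%:R / k%:R))%R ->
  (k%:R * (normal_itv_mass R * (tau ^+ 2 / 4)))%:E <=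
  bayes_risk X sigma (prior d k tau) loss_est (sparse_vectors d k).
Proof.
move=> k0 kd2 s0 sL; apply: bayes_risk_est_ge => est j.
have mb := measurable_est_coord est j.
have k1 : (0 < k%:R :> R)%R by rewrite ltr0n.
have d1 : (0 < d%:R :> R)%R by rewrite ltr0n (leq_trans k0).
have q1 : (0 < 1 + s)%R by rewrite ltr_pwDl.
have q0 : (0 < (Num.sqrt (1 + s))^-1)%R by rewrite invr_gt0 sqrtr_gt0.
have dk : (d%:R / k%:R / 2 <= (d - k)%:R / k%:R :> R)%R.
  rewrite natrB// mulrAC ler_wpM2r ?invr_ge0//.
  by move: kd2; rewrite -(ler_nat R) natrM; lra.
apply: (sum_support_ge k0 kd (ltW q0)).
- by move=> K; exact: coord_risk_ge0.
- move=> K jK; apply: coord_risk_pair => //.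
    rewrite mulr_gt0// (lt_le_trans _ dk)// !divr_gt0//.
  apply: (@le_trans _ _ (2 * (d%:R / k%:R / 2 * (Num.sqrt (1 + s))^-1))%R); last first.
    by rewrite ler_pM2l// ler_pM2r.
  rewrite mulrA mulrCA divff// mulr1 ler_pdivlMr ?sqrtr_gt0//.
  apply: (@le_trans _ _ (expR (4 * s) * expR (s / 2))%R).
    rewrite ler_pM2l ?expR_gt0//.
    rewrite -[leRHS]ger0_norm ?expR_ge0// -sqrtr_sqr ler_wsqrtr//.
    rewrite expr2 -expRD -splitr; exact: expR_ge1Dx.
  rewrite -expRD -[leRHS]lnK ?posrE ?divr_gt0// ler_expR.
  by apply: le_trans sL; lra.
- by move=> K i iK ij; exact: coord_risk_other.
Qed.
End bayes_est.

(** * Sparse projections and measurable selection *)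

Section projection.
Context (R : realType).

(** The squared norm as a matrix product, which makes the normal equations of
    least squares a matter of matrix algebra. *)
Definition sqnorm n (v : 'cV[R]_n) : R := (v^T *m v) 0 0.

Lemma norm2_sqnorm n (v : 'cV[R]_n) : norm2 v ^+ 2 = sqnorm v.
Proof. by rewrite norm2_sq /sqnorm mxE; apply: eq_bigr => i _; rewrite mxE expr2. Qed.

Lemma sqnorm_ge0 n (v : 'cV[R]_n) : 0 <= sqnorm v.
Proof. by rewrite -norm2_sqnorm sqr_ge0. Qed.

Lemma sqnorm_eq0 n (v : 'cV[R]_n) : sqnorm v = 0 -> v = 0.
Proof.
rewrite -norm2_sqnorm norm2_sq => /psumr_eq0P v0; apply/matrixP => i j.
rewrite ord1 [RHS]mxE; apply/eqP; rewrite -sqrf_eq0; apply/eqP.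
by apply: v0 => // l _; exact: sqr_ge0.
Qed.

Lemma sqnormD n (u v : 'cV[R]_n) :
  sqnorm (u + v) = sqnorm u + sqnorm v + 2 * (u^T *m v) 0 0.
Proof.
rewrite /sqnorm [(u + v)^T]linearD mulmxDl !mulmxDr !mxE.
have -> : \sum_j v^T 0 j * u j 0 = \sum_j u^T 0 j * v j 0.
  by apply: eq_bigr => j _; rewrite !mxE mulrC.
by ring.
Qed.

Lemma sqnormD_le n (u v : 'cV[R]_n) :
  sqnorm (u + v) <= 2 * sqnorm u + 2 * sqnorm v.
Proof.
have : 0 <= sqnorm (u - v) by exact: sqnorm_ge0.
have vN : sqnorm (- v) = sqnorm v.
  by rewrite /sqnorm [(- v)^T]linearN mulNmx mulmxN opprK.
have uvN : (u^T *m - v) 0 0 = - (u^T *m v) 0 0 by rewrite mulmxN mxE.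
rewrite !sqnormD vN uvN; lra.
Qed.

(** With D the projection on the coordinates in K and A = X^T X, the matrix
    G = D A D + (1 - D) is invertible as soon as X is injective on vectors supported
    in K.  The solution b of G b = D A a is supported in K and satisfies the normal
    equations of the least-squares problem: X b is the orthogonal projection of X a
    on the span of the columns of X in K. *)
Lemma restricted_projection n d (X : 'M[R]_(n, d)) (K : {set 'I_d}) :
  (forall v : 'cV[R]_d, (forall i, i \notin K -> v i 0 = 0) -> X *m v = 0 -> v = 0) ->
  exists P : 'M[R]_d,
    (forall a i, i \notin K -> (P *m a : 'cV[R]_d) i 0 = 0) /\
    (forall a theta : 'cV[R]_d, (forall i, i \notin K -> theta i 0 = 0) ->
      sqnorm (X *m (P *m a - a)) <= sqnorm (X *m (theta - a))).
Proof.
move=> injX.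
pose D : 'M[R]_d := diag_mx (\row_i (i \in K)%:R).
have DT : D^T = D by rewrite tr_diag_mx.
have DE (v : 'cV[R]_d) i : (D *m v) i 0 = (i \in K)%:R * v i 0.
  by rewrite mul_diag_mx !mxE.
have DK (v : 'cV[R]_d) : (forall i, i \notin K -> v i 0 = 0) -> D *m v = v.
  move=> vK; apply/matrixP => i j; rewrite ord1 DE.
  by case: (boolP (i \in K)) => [_|/vK ->]; rewrite ?mul1r ?mulr0.
have KD (v : 'cV[R]_d) : D *m v = v -> forall i, i \notin K -> v i 0 = 0.
  by move=> <- i /negbTE iK; rewrite DE iK mul0r.
have DD : D *m D = D.
  rewrite mulmx_diag; congr diag_mx; apply/rowP => i; rewrite !mxE.
  by case: (i \in K); rewrite ?mulr1 ?mulr0.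
pose A := X^T *m X.
pose G := D *m A *m D + (1%:M - D).
have AT : A^T = A by rewrite /A trmx_mul trmxK.
have GT : G^T = G.
  by rewrite /G [(_ + _)^T]linearD/= (trmx_mul _ D) (trmx_mul D A) [(_ - _)^T]linearB/=
    trmx1 DT AT mulmxA.
have E1 : (1%:M - D) *m D = 0 by rewrite mulmxBl mul1mx DD subrr.
have EG : (1%:M - D) *m G = 1%:M - D.
  by rewrite /G mulmxDr !mulmxA E1 !mul0mx add0r mulmxBr mulmx1 E1 subr0.
have split_G (b w : 'cV[R]_d) : G *m b = D *m w -> D *m b = b /\ D *m A *m b = D *m w.
  move=> Gb; have Db : D *m b = b.
    have : (1%:M - D) *m (G *m b) = 0 by rewrite Gb mulmxA E1 mul0mx.
    by rewrite mulmxA EG mulmxBl mul1mx => /eqP; rewrite subr_eq0 => /eqP.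
  split=> //; move: Gb; rewrite /G mulmxDl mulmxBl mul1mx Db subrr addr0.
  by rewrite -[_ *m D *m b]mulmxA Db.
have uG : G \in unitmx.
  rewrite -row_free_unit; apply: inj_row_free => u uG0.
  have : G *m u^T = D *m 0 by rewrite -[G]GT -trmx_mul uG0 trmx0 mulmx0.
  move=> /split_G[Du DAu]; apply: trmx_inj; rewrite trmx0.
  apply: injX; first exact: KD.
  apply: sqnorm_eq0; rewrite /sqnorm trmx_mul -mulmxA (mulmxA X^T) -/A.
  by rewrite -{1}Du trmx_mul DT -mulmxA (mulmxA D) DAu !mulmx0 mxE.
exists (invmx G *m D *m A); split => [a|a theta thetaK].
  apply: KD; apply: (proj1 (split_G _ (A *m a) _)).
  by rewrite !mulmxA mulmxV// mul1mx.
set b := _ *m a.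
have [Db DAb] : D *m b = b /\ D *m A *m b = D *m (A *m a).
  by apply: split_G; rewrite /b !mulmxA mulmxV// mul1mx.
have -> : X *m (theta - a) = X *m (theta - b) + X *m (b - a).
  by rewrite -mulmxDr addrA subrK.
rewrite sqnormD; have -> : ((X *m (theta - b))^T *m (X *m (b - a))) 0 0 = 0.
  have Dtb : D *m (theta - b) = theta - b by rewrite mulmxBr Db DK.
  rewrite trmx_mul -mulmxA (mulmxA X^T) -/A -Dtb trmx_mul DT -mulmxA (mulmxA D).
  by rewrite mulmxBr DAb mulmxA subrr mulmx0 mxE.
by rewrite mulr0 addr0 lerDr sqnorm_ge0.
Qed.
End projection.

Section measurable_choice.
Context d d' (Y : measurableType d) (Z : measurableType d') (R : realType).

(** Comparing finitely many candidates one after the other selects a minimizer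
    by a finite number of measurable tests. *)
Lemma measurable_argmin (I : eqType) (s : seq I) (c : I -> Y -> Z) (cost : Y * Z -> R) :
  s != [::] -> (forall i, measurable_fun setT (c i)) -> measurable_fun setT cost ->
  exists h : Y -> Z, [/\ measurable_fun setT h,
    forall y, exists2 i, i \in s & h y = c i y &
    forall y i, i \in s -> cost (y, h y) <= cost (y, c i y)].
Proof.
move=> + mc mcost; elim: s => // i0 s IHs _.
have [s0|sn] := eqVneq s [::].
  exists (c i0); split=> // [y|y i].
    by exists i0 => //; rewrite mem_head.
  by rewrite s0 inE => /eqP ->.
have [h [mh hc hmin]] := IHs sn.
exists (fun y => if cost (y, c i0 y) <= cost (y, h y) then c i0 y else h y); split.
- apply: measurable_fun_ifT => //; apply: measurable_fun_ler.
    by apply: measurableT_comp => //; exact: measurable_fun_pair.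
  by apply: measurableT_comp => //; exact: measurable_fun_pair.
- move=> y; case: ifP => _; first by exists i0 => //; rewrite mem_head.
  by have [i si ->] := hc y; exists i => //; rewrite inE si orbT.
- move=> y i; rewrite inE => /predU1P[->|si].
    by case: ifP => // /negbT; rewrite -ltNge => /ltW.
  by case: ifP => [/le_trans|_]; [apply|]; exact: hmin.
Qed.
End measurable_choice.

(** * From prediction to estimation *)

Lemma colB_E (R : zmodType) n (u v : 'cV[R]_n) i : (u - v) i 0 = u i 0 - v i 0.
Proof. by rewrite !mxE. Qed.

Section prediction.
Context (R : realType) (n d k : nat) (X : 'M[R]_(n, d)) (kappa_u kappa_l sigma : R).
Hypotheses (n0 : (0 < n)%N) (kd : (k <= d)%N) (kl0 : 0 < kappa_l) (sigma0 : 0 < sigma).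
Hypothesis eigX : sparse_eigenvalue_condition X (2 * k)%N kappa_u kappa_l.

Lemma card_superset (S : {set 'I_d}) : (#|S| <= k)%N ->
  exists2 K : {set 'I_d}, S \subset K & #|K| = k.
Proof.
move Em : (k - #|S|)%N => m; elim: m S Em => [|m IHm] S Em Sk.
  by exists S => //; apply/eqP; rewrite eqn_leq Sk -subn_eq0 Em eqxx.
have Slk : (#|S| < k)%N by rewrite -subn_gt0 Em.
have [i iS] : exists i, i \notin S.
  apply/existsP; rewrite -negb_forall; apply/negP => /forallP H.
  have ST : S = [set: 'I_d]%SET by apply/setP => i; rewrite inE H.
  by move: Slk; rewrite ST cardsT card_ord ltnNge kd.
have ciS : #|i |: S| = #|S|.+1 by rewrite cardsU1 iS.
have [||K /fintype.subsetP SK Kk] := IHm (i |: S).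
- by rewrite ciS subnS Em.
- by rewrite ciS.
exists K => //; apply/fintype.subsetP => l lS; apply: SK.
by rewrite in_setU1 lS orbT.
Qed.

Lemma norm0_le (K : {set 'I_d}) (v : 'cV[R]_d) :
  (forall i, i \notin K -> v i 0 = 0) -> (norm0 v <= #|K|)%N.
Proof.
move=> vK; apply/subset_leq_card/fintype.subsetP => i; rewrite inE.
by apply: contraR => /vK ->; rewrite eqxx.
Qed.

Lemma eigen_sqnorm (v : 'cV[R]_d) : (norm0 v <= 2 * k)%N ->
  kappa_l ^+ 2 * sqnorm v <= n%:R^-1 * sqnorm (X *m v).
Proof.
move=> /eigX/andP[+ _] => H; rewrite -!norm2_sqnorm.
have sn : 0 < Num.sqrt n%:R :> R by rewrite sqrtr_gt0 ltr0n.
have -> : n%:R^-1 * norm2 (X *m v) ^+ 2 = (norm2 (X *m v) / Num.sqrt n%:R) ^+ 2.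
  by rewrite expr_div_n (sqr_sqrtr (ler0n R n)) mulrC.
rewrite -exprMn lerXn2r// nnegrE.
  by rewrite mulr_ge0// ?sqrtr_ge0// ltW.
by rewrite divr_ge0// ?sqrtr_ge0.
Qed.

Lemma sparse_injective (K : {set 'I_d}) : #|K| = k ->
  forall v : 'cV[R]_d, (forall i, i \notin K -> v i 0 = 0) -> X *m v = 0 -> v = 0.
Proof.
move=> Kk v vK Xv; apply: sqnorm_eq0; apply/eqP.
have := eigen_sqnorm (v := v); rewrite Xv -[X in n%:R^-1 * X]norm2_sqnorm.
have -> : norm2 (0 : 'cV[R]_n) ^+ 2 = 0.
  by rewrite norm2_sq big1// => i _; rewrite mxE expr0n.
rewrite mulr0 => H; have {}H := H _.
rewrite eq_le sqnorm_ge0 andbT -(pmulr_rle0 _ (exprn_gt0 2 kl0)); apply: H.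
by apply: leq_trans (norm0_le vK) _; rewrite Kk leq_pmull.
Qed.

Lemma loss_preE (theta theta' : 'cV[R]_d) :
  loss_pre X theta theta' = n%:R^-1 * sqnorm (X *m (theta' - theta)).
Proof. by rewrite /loss_pre norm2_sqnorm -mulmxBr. Qed.

(** The k-sparse vector that best reproduces the prediction of est is at least as
    good a fit as theta, so by the triangle inequality its prediction is at most
    twice as far from that of theta; squaring gives the factor 4.  Being a minimizer
    over finitely many linear projections, it depends measurably on y. *)
Lemma sparse_estimator (est : {mfun n.-tuple R >-> d.-tuple R}) :
  exists est' : {mfun n.-tuple R >-> d.-tuple R}, forall theta y,
    sparse_vectors d k theta ->
    kappa_l ^+ 2 / 4 * loss_est (vec theta) (vec (est' y)) <=
    loss_pre X (vec theta) (vec (est y)).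
Proof.
have /boolp.choice[P PP] : forall K : {set 'I_d}, exists P : 'M[R]_d, #|K| = k ->
    (forall a i, i \notin K -> (P *m a : 'cV[R]_d) i 0 = 0) /\
    (forall a theta : 'cV[R]_d, (forall i, i \notin K -> theta i 0 = 0) ->
      sqnorm (X *m (P *m a - a)) <= sqnorm (X *m (theta - a))).
  move=> K; have [Kk|Kk] := eqVneq #|K| k; last by exists 0 => /eqP; rewrite (negbTE Kk).
  by have [P HP] := restricted_projection (sparse_injective Kk); exists P.
pose c (K : {set 'I_d}) (y : n.-tuple R) : d.-tuple R :=
  [tuple (P K *m vec (est y)) i 0 | i < d].
have vc K y : vec (c K y) = P K *m vec (est y).
  by apply/matrixP => i j; rewrite ord1 mxE tnth_mktuple.
have mc K : measurable_fun setT (c K).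
  apply/measurable_fun_tnthP => i.
  rewrite [F in measurable_fun _ F](_ : _ =
      (fun theta : d.-tuple R => (P K *m vec theta) i 0) \o est).
    by apply: measurableT_comp => //; exact: measurable_mulmx_vec.
  by apply/funext => y; rewrite /= tnth_mktuple.
pose cost (z : n.-tuple R * d.-tuple R) : R :=
  \sum_i ((X *m vec z.2) i 0 - (X *m vec (est z.1)) i 0) ^+ 2.
have costE y theta : cost (y, theta) = sqnorm (X *m (vec theta - vec (est y))).
  rewrite -norm2_sqnorm norm2_sq; apply: eq_bigr => i _.
  by rewrite mulmxBr colB_E.
have mcost : measurable_fun setT cost.
  apply: measurable_sum => i; apply: measurable_funX; apply: measurable_funB.
    exact: (measurableT_comp (measurable_mulmx_vec X i) measurable_snd).
  apply: (measurableT_comp (measurable_mulmx_vec X i)).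
  exact: measurableT_comp.
pose s := enum [pred K : {set 'I_d} | #|K| == k].
have sP K : (K \in s) = (#|K| == k) by rewrite mem_enum.
have sn : s != [::].
  have := @card_superset finset.set0; rewrite cards0 => /(_ isT)[K _ Kk].
  by apply/eqP => s0; have := sP K; rewrite s0 Kk eqxx.
have [h [mh hc hmin]] := measurable_argmin sn mc mcost.
pose est' : {mfun n.-tuple R >-> d.-tuple R} :=
  HB.pack h (isMeasurableFun.Build _ _ _ _ h mh).
exists est' => theta y; rewrite /sparse_vectors/= => sth.
pose supp : {set 'I_d} := finset (fun i => vec theta i 0 != 0).
have sth' : (#|supp| <= k)%N by rewrite cardsE.
have [K0 /fintype.subsetP SK0 K0k] := card_superset sth'.
have tK0 i : i \notin K0 -> vec theta i 0 = 0.
  by move=> iK; apply/eqP; apply: contraNT iK => ti; apply: SK0; rewrite inE.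
have [K Ks hE] := hc y.
have Kk : #|K| = k by apply/eqP; rewrite -sP.
have est'K i : i \notin K -> vec (h y) i 0 = 0.
  by move=> iK; rewrite hE vc; apply: (proj1 (PP K Kk)).
have le1 : sqnorm (X *m (vec (h y) - vec (est y))) <= sqnorm (X *m (vec theta - vec (est y))).
  rewrite -costE; apply: le_trans (hmin y K0 _) _; first by rewrite sP K0k.
  by rewrite costE vc; apply: (proj2 (PP K0 K0k)).
have le2 : sqnorm (X *m (vec (h y) - vec theta)) <= 4 * sqnorm (X *m (vec (est y) - vec theta)).
  have sqN (v : 'cV[R]_n) : sqnorm (- v) = sqnorm v.
    by rewrite -!norm2_sqnorm !norm2_sq; apply: eq_bigr => i _; rewrite mxE sqrrN.
  have e1 : sqnorm (X *m (vec theta - vec (est y))) = sqnorm (X *m (vec (est y) - vec theta)).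
    by rewrite -opprB mulmxN sqN.
  have -> : X *m (vec (h y) - vec theta) =
      X *m (vec (h y) - vec (est y)) + X *m (vec (est y) - vec theta).
    by rewrite -mulmxDr addrA subrK.
  apply: le_trans (sqnormD_le _ _) _; rewrite e1 in le1.
  by move: le1; lra.
rewrite loss_preE /loss_est norm2_sqnorm.
have sp : (norm0 (vec (h y) - vec theta) <= 2 * k)%N.
  apply: leq_trans (norm0_le (K := K :|: K0) _) _.
    move=> i; rewrite finset.in_setU negb_or => /andP[iK iK0].
    by rewrite colB_E est'K// tK0// subr0.
  by apply: leq_trans (leq_card_setU _ _) _; rewrite Kk K0k mul2n addnn.
have := eigen_sqnorm sp.
have n1 : 0 <= n%:R^-1 :> R by rewrite invr_ge0.
have := ler_wpM2l n1 le2.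
rewrite -[vec (est' y)]/(vec (h y)).
lra.
Qed.

Lemma bayes_risk_pre_ge (tau : R) :
  ((kappa_l ^+ 2 / 4)%:E *
    bayes_risk X sigma (prior d k tau) loss_est (sparse_vectors d k) <=
  bayes_risk X sigma (prior d k tau) (loss_pre X) (sparse_vectors d k))%E.
Proof.
apply: le_ereal_inf_tmp => _ [est _ <-].
have [est' est'P] := sparse_estimator est.
have c0 : 0 <= kappa_l ^+ 2 / 4 by rewrite divr_ge0// sqr_ge0.
have mS := @measurable_sparse_vectors R d k.
have mcoord (f : {mfun n.-tuple R >-> d.-tuple R}) i :
    measurable_fun setT (fun y => tnth (f y) i).
  exact: (measurableT_comp (measurable_tnth i)).
have mF : measurable_fun setT (fun z : d.-tuple R * n.-tuple R =>
    (loss_est (vec z.1) (vec (est' z.2)))%:E).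
  apply/measurable_EFinP; under eq_fun do rewrite loss_estE.
  apply: measurable_sum => i; apply: measurable_funX; apply: measurable_funB.
    exact: (measurableT_comp (mcoord est' i) measurable_snd).
  exact: (measurableT_comp (measurable_tnth i) measurable_fst).
have mX i := measurable_mulmx_vec X i.
have mF' : measurable_fun setT (fun z : d.-tuple R * n.-tuple R =>
    (loss_pre X (vec z.1) (vec (est z.2)))%:E).
  apply/measurable_EFinP; rewrite /loss_pre.
  apply: measurable_funM => //; under eq_fun do rewrite norm2_sq.
  apply: measurable_sum => i; apply: measurable_funX.
  under eq_fun do rewrite colB_E.
  apply: measurable_funB.
    apply: (measurableT_comp (mX i)); exact: measurableT_comp.
  exact: (measurableT_comp (mX i) measurable_fst).
have F0 (z : d.-tuple R * n.-tuple R) :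
    (0 <= (loss_est (vec z.1) (vec (est' z.2)))%:E)%E by rewrite lee_fin sqr_ge0.
have F'0 (z : d.-tuple R * n.-tuple R) :
    (0 <= (loss_pre X (vec z.1) (vec (est z.2)))%:E)%E.
  by rewrite lee_fin mulr_ge0 ?sqr_ge0// invr_ge0.
have mE := measurable_integral_gaussian X sigma0 mF F0.
have mP := measurable_integral_gaussian X sigma0 mF' F'0.
have E0 theta : (0 <= \int[gaussian (X *m vec theta) sigma]_y
    (loss_est (vec theta) (vec (est' y)))%:E)%E.
  by apply: integral_ge0 => y _; exact: (F0 (theta, y)).
apply: (@le_trans _ _ ((kappa_l ^+ 2 / 4)%:E *
  \int[prior d k tau]_(theta in sparse_vectors d k)
    \int[gaussian (X *m vec theta) sigma]_y (loss_est (vec theta) (vec (est' y)))%:E)%E).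
  apply: lee_wpmul2l; first by rewrite lee_fin.
  by apply: ereal_inf_lbound; exists est'.
rewrite -ge0_integralZl//; last exact: measurable_funTS.
apply: ge0_le_integral => //.
- by move=> theta _; rewrite mule_ge0.
- by apply: emeasurable_funM => //; exact: measurable_funTS.
- exact: measurable_funTS.
move=> theta sth.
have mFt := measurableT_comp mF (pair1_measurable theta).
rewrite -ge0_integralZl//; last by move=> y _; exact: (F0 (theta, y)).
apply: ge0_le_integral => //.
- by move=> y _; rewrite mule_ge0 ?lee_fin//; have := F0 (theta, y).
- exact: emeasurable_funM.
- exact: (measurableT_comp mF' (pair1_measurable theta)).
- by move=> y _; rewrite -EFinM lee_fin; exact: est'P.
Qed.
End prediction.

(** * The rate *)

(** A basis vector is 1-sparse, and X maps it to a column. *)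
Lemma eigen_col (R : realType) (n d k : nat) (X : 'M[R]_(n, d)) (kappa_u kappa_l : R) i :
  (0 < n)%N -> (0 < k)%N -> 0 < kappa_u ->
  sparse_eigenvalue_condition X (2 * k)%N kappa_u kappa_l ->
  norm2 (col i X) ^+ 2 <= kappa_u ^+ 2 * n%:R.
Proof.
move=> n0 k0 ku0 eigX; have sn : 0 < Num.sqrt n%:R :> R by rewrite sqrtr_gt0 ltr0n.
have sp : (norm0 (delta_mx i 0%R : 'cV[R]_d) <= 2 * k)%N.
  apply: leq_trans (norm0_le (K := finset.set1 i) _) _.
    by move=> l; rewrite finset.in_set1 mxE => /negbTE ->.
  by rewrite cards1 muln_gt0 k0.
have /andP[_] := eigX _ sp.
have -> : norm2 (delta_mx i 0 : 'cV[R]_d) = 1.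
  rewrite /norm2 (bigD1 i)//= mxE !eqxx expr1n big1 ?addr0 ?sqrtr1// => l li.
  by rewrite mxE (negbTE li) expr0n.
rewrite mulr1 -colE ler_pdivrMr// => H.
rewrite -[n%:R]sqr_sqrtr ?ler0n// -exprMn lerXn2r// nnegrE ?sqrtr_ge0//.
by rewrite mulr_ge0 ?sqrtr_ge0// ltW.
Qed.

(** The exponent is at most ln (d / k) / 4 - 4 s, which is below - s when
    ln (d / k) < 12 s, and exp (- s) <= 1 / (1 + s). *)
Lemma T_rate_le (R : realType) (n d k : nat) (kappa_u sigma tau : R) :
  (0 < n)%N -> 0 < kappa_u -> 0 < sigma -> 0 < tau ->
  let s := kappa_u ^+ 2 * tau ^+ 2 * n%:R / sigma ^+ 2 in
  T_rate n d k kappa_u sigma tau <= k%:R * tau ^+ 2 /\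
  (ln (d%:R / k%:R) < 12 * s ->
   T_rate n d k kappa_u sigma tau <= k%:R * (tau ^+ 2 / (1 + s))).
Proof.
move=> n0 ku0 s0 t0 s; rewrite /T_rate; set L := ln _.
have n1 : 0 < n%:R :> R by rewrite ltr0n.
have sp : 0 < s by rewrite /s divr_gt0 ?mulr_gt0 ?exprn_gt0.
have c0 : 0 <= k%:R * tau ^+ 2 :> R by rewrite mulr_ge0// sqr_ge0.
set M := Num.max (_ - _) 0; rewrite -/s.
have M0 : 0 <= M by rewrite le_max lexx orbT.
have a0 : 0 < 4 * kappa_u ^+ 2 * n%:R / sigma ^+ 2.
  by rewrite divr_gt0 ?mulr_gt0 ?exprn_gt0.
split=> [|Ls].
  rewrite -[leRHS]mulr1 ler_wpM2l// ge_max; apply/andP; split.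
    by rewrite ler_pdivrMr; lra.
  by rewrite -[leRHS]expR0 ler_expR oppr_le0; exact: (mulr_ge0 (ltW a0) M0).
rewrite [leRHS]mulrA ler_wpM2l// ge_max; apply/andP; split.
  by rewrite mul1r.
apply: (@le_trans _ _ (expR (- s))).
  rewrite ler_expR lerN2.
  apply: (@le_trans _ _ (4 * kappa_u ^+ 2 * n%:R / sigma ^+ 2 *
     (tau ^+ 2 - sigma ^+ 2 * L / (16 * kappa_u ^+ 2 * n%:R)))); last first.
    by rewrite ler_wpM2l ?(ltW a0)// le_max lexx.
  have -> : 4 * kappa_u ^+ 2 * n%:R / sigma ^+ 2 *
     (tau ^+ 2 - sigma ^+ 2 * L / (16 * kappa_u ^+ 2 * n%:R)) = 4 * s - L / 4.
    by rewrite /s; field; rewrite !gt_eqF.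
  lra.
rewrite expRN lef_pV2 ?posrE ?expR_gt0//; last by lra.
exact: expR_ge1Dx.
Qed.

Theorem theorem7p1 (R : realType) :
  exists c' c'' : R, 0 < c' /\ 0 < c'' /\
  forall (n d k : nat) (X : 'M[R]_(n, d)) (kappa_u kappa_l sigma : R),
    (0 < n)%N -> (0 < k)%N -> (k ^ 3 < d)%N ->
    0 < kappa_u -> 0 < kappa_l -> 0 < sigma ->
    sparse_eigenvalue_condition X (2 * k)%N kappa_u kappa_l ->
  forall tau : R, 0 < tau ->
    ((c' * T_rate n d k kappa_u sigma tau)%:E <=
       bayes_risk X sigma (prior d k tau) loss_est
         (sparse_vectors d k))%E /\
    ((c'' * kappa_l ^+ 2 * T_rate n d k kappa_u sigma tau)%:E <=
       bayes_risk X sigma (prior d k tau) (loss_pre X)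
         (sparse_vectors d k))%E.
Proof.
pose p := normal_itv_mass R; have p0 : 0 < p by exact: normal_itv_mass_gt0.
(* One factor 1 / 4 comes from gaussian_two_point, the other one from
   sparse_estimator. *)
exists (p / 4), (p / 4 / 4); split; first by rewrite divr_gt0.
split; first by rewrite divr_gt0// divr_gt0.
move=> n d k X kappa_u kappa_l sigma n0 k0 kd ku0 kl0 s0 eigX tau t0.
pose s := kappa_u ^+ 2 * tau ^+ 2 * n%:R / sigma ^+ 2.
have s_ge0 : 0 <= s by rewrite divr_ge0 ?sqr_ge0// mulr_ge0// mulr_ge0// sqr_ge0.
have kd2 : (2 * k <= d)%N.
  apply: leq_trans kd; case: k k0 {eigX} => [//|[//|k]] _.
  by rewrite expnS (leq_trans _ (leqnSn _))// mulnC leq_mul2l/= (@leq_trans (k.+2 ^ 1))// leq_exp2l.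
have kd1 : (k <= d)%N by apply: leq_trans kd2; rewrite leq_pmull.
have snr i : tau ^+ 2 * (norm2 (col i X) ^+ 2 / sigma ^+ 2) <= s.
  rewrite (_ : s = tau ^+ 2 * (kappa_u ^+ 2 * n%:R / sigma ^+ 2)).
    rewrite ler_wpM2l ?sqr_ge0// ler_wpM2r ?invr_ge0 ?sqr_ge0//.
    exact: (eigen_col i n0 k0 ku0 eigX).
  by rewrite /s; field; rewrite gt_eqF.
have [T1 T2] := T_rate_le d k n0 ku0 s0 t0.
have est : ((p / 4 * T_rate n d k kappa_u sigma tau)%:E <=
    bayes_risk X sigma (prior d k tau) loss_est (sparse_vectors d k))%E.
  have [sL|Ls] := leP (12 * s) (ln (d%:R / k%:R)).
    apply: le_trans (bayes_risk_est_sparse s0 t0 kd1 snr k0 kd2 s_ge0 sL).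
    rewrite lee_fin -/p (_ : k%:R * _ = p / 4 * (k%:R * tau ^+ 2)); last by ring.
    by rewrite ler_wpM2l// divr_ge0// ltW.
  apply: le_trans (bayes_risk_est_oracle s0 t0 kd1 snr).
  rewrite lee_fin -/p (_ : k%:R * _ = p * (k%:R * (tau ^+ 2 / (1 + s)))); last by ring.
  have {}T2 := T2 Ls.
  have U0 : 0 <= k%:R * (tau ^+ 2 / (1 + s)).
    by rewrite mulr_ge0// divr_ge0 ?sqr_ge0// addr_ge0.
  apply: (@le_trans _ _ (p / 4 * (k%:R * (tau ^+ 2 / (1 + s))))).
    by rewrite ler_wpM2l// divr_ge0// ltW.
  by rewrite ler_wpM2r//; lra.
split; first exact: est.
apply: le_trans (bayes_risk_pre_ge n0 kd1 kl0 s0 eigX tau).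
apply: (@le_trans _ _ ((kappa_l ^+ 2 / 4)%:E * (p / 4 * T_rate n d k kappa_u sigma tau)%:E)%E).
  by rewrite -EFinM lee_fin le_eqVlt; apply/orP; left; apply/eqP; field.
by apply: lee_wpmul2l => //; rewrite lee_fin divr_ge0// sqr_ge0.
Qed.
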